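(* Let $X$ be a nonempty compact metrizable space, $\varphi:X\to X$ a continuous, locally injective surjection, $D=D_{\Gamma_\varphi}$, $F\in D$ real-valued, and $m(x)=\#\varphi^{-1}(\varphi(x))$ for $x\in X$. When $\beta>0$ is the inverse temperature of a KMS state for $\alpha^F$ we have $$A^\varphi_{\log m}\le\beta B^\varphi_F\quad\text{and}\quad \beta A^\varphi_F\le h_m(\varphi).$$ When $\beta<0$ is the inverse temperature of a KMS state for $\alpha^F$ we have $$A^\varphi_{\log m}\le\beta A^\varphi_F\quad\text{and}\quad \beta B^\varphi_F\le h_m(\varphi).$$
   Context: $\mathbb N=\{0,1,2,\dots\}$. Locally injective means that the topology of $X$ has a basis consisting of sets on which $\varphi$ is injective. Groupoid: $\Gamma_\varphi=\{(x,k,y)\in X\times\mathbb Z\times X:\exists a,b\in\mathbb N,\ k=a-b,\ \varphi^a(x)=\varphi^b(y)\}$, with product $(x,k,y)(y,k',y')=(x,k+k',y')$ and inverse $(x,k,y)^{-1}=(y,-k,x)$. For $k\in\mathbb Z$ and $n\in\mathbb N$ with $n+k\ge 0$ let $\Gamma_\varphi(k,n)=\{(x,l,y)\in X\times\mathbb Z\times X: l=k,\ \varphi^{k+i}(x)=\varphi^i(y)\ \text{for all } i\ge n\}$ with the relative topology from $X\times\mathbb Z\times X$; $\Gamma_\varphi(k,n)$ is open in $\Gamma_\varphi(k,n+1)$. $\Gamma_\varphi(k)=\bigcup_{n}\Gamma_\varphi(k,n)$ has the inductive limit topology, and $\Gamma_\varphi=\bigsqcup_k\Gamma_\varphi(k)$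 has the topology in which each $\Gamma_\varphi(k)$ is open and closed. The unit space is identified with $X$ via $x\mapsto(x,0,x)$. Algebras: $\mathrm{alg}^*\Gamma_\varphi$ is the $*$-algebra of functions on $\Gamma_\varphi$ generated by the continuous compactly supported functions under the convolution $f\star g(x,k,y)=\sum_{z,\,n+m=k}f(x,n,z)g(z,m,y)$ and the involution $f^*(x,k,y)=\overline{f(y,-k,x)}$. $C^*_r(\Gamma_\varphi)$ is its completion in the reduced norm $\|f\|=\sup_{x\in X}\|\pi_x(f)\|$, where $\pi_x$ is the representation on $\ell^2(\{(z,k,y)\in\Gamma_\varphi:y=x\})$ given by $(\pi_x(f)\xi)(\gamma)=\sum_{\gamma_1\gamma_2=\gamma}f(\gamma_1)\xi(\gamma_2)$. $D_{\Gamma_\varphi}$ is the closure in $C^*_r(\Gamma_\varphi)$ of the set of elements of $\mathrm{alg}^*\Gamma_\varphi$ supported in the unit space; it is an abelian $C^*$-algebra of bounded functions on $X$ (supremum norm) containing $C(X)$. $V_\varphi\in C^*_r(\Gamma_\varphi)$ is the isometry $V_\varphi(x,k,y)=m(x)^{-1/2}$ if $k=1$ and $y=\varphi(x)$, and $0$ otherwise; $C^*_r(\Gamma_\varphi)$ is generated by $D_{\Gamma_\varphi}$ and $V_\varphi$. For real-valued $F\in D$, $\alpha^F:\mathbb R\to\mathrm{Aut}\,C^*_r(\Gamma_\varphi)$ is the continuous action with $\alpha^F_t(d)=d$ for $d\in D$ and $\alpha^F_t(V_\varphi)=e^{iFt}V_\varphi$. For $\beta\in\mathbb R\setminus\{0\}$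 a KMS state for $\alpha^F$ with inverse temperature $\beta$ ($\beta$-KMS state) is a state $\omega$ of $C^*_r(\Gamma_\varphi)$ with $\omega(xy)=\omega(y\,\alpha^F_{i\beta}(x))$ for all $\alpha^F$-analytic $x,y$. $h_m(\varphi)=\lim_{n\to\infty}\frac1n\log\left(\max_{x\in X}\#\varphi^{-n}(x)\right)$. For bounded $H:X\to\mathbb R$: $A^\varphi_H=\lim_{k\to\infty}\frac1k\inf_{x\in X}\sum_{j=0}^{k-1}H(\varphi^j(x))$ and $B^\varphi_H=\lim_{k\to\infty}\frac1k\sup_{x\in X}\sum_{j=0}^{k-1}H(\varphi^j(x))$ (both limits exist). *)

(* Defs.v *)
From HB Require Import structures.
From mathcomp Require Import all_boot all_order all_algebra.
From mathcomp Require Import finmap.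
From mathcomp Require Import all_classical all_reals all_analysis.
From mathcomp Require Export complex.

Set Implicit Arguments.
Unset Strict Implicit.
Unset Printing Implicit Defensive.

Import Order.TTheory GRing.Theory Num.Theory.
Import numFieldNormedType.Exports.

Local Open Scope classical_set_scope.
Local Open Scope ring_scope.
Local Open Scope complex_scope.

(* On a complex normed space [`|a|] lives in R[i]; [rnorm a] is the same number
   as an element of R. *)
Definition rnorm (R : realType) (V : normedModType R[i]) (a : V) : R :=
  complex.Re `|a|.

(* The ring and norm hierarchies have no common structure over R[i], hence a
   plain record. Only unital algebras are needed: X is compact, so the indicator
   function of the unit space is a unit of alg* Gamma_phi. *)
Record cstarAlg (R : realType) := CStarAlg {
  cstar_sort :> completeNormedModType R[i] ;
  cmul : cstar_sort -> cstar_sort -> cstar_sort ;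
  cone : cstar_sort ;
  cstar : cstar_sort -> cstar_sort ;
  cmulA : associative cmul ;
  cmul1l : left_id cone cmul ;
  cmul1r : right_id cone cmul ;
  cmulDl : left_distributive cmul +%R ;
  cmulDr : right_distributive cmul +%R ;
  cmulZl : forall (c : R[i]) a b, cmul (c *: a) b = c *: cmul a b ;
  cmulZr : forall (c : R[i]) a b, cmul a (c *: b) = c *: cmul a b ;
  cstarK : involutive cstar ;
  cstarD : {morph cstar : a b / a + b} ;
  cstarZ : forall (c : R[i]) a, cstar (c *: a) = c^* *: cstar a ;
  cstarM : forall a b, cstar (cmul a b) = cmul (cstar b) (cstar a) ;
  cnormM : forall a b, `|cmul a b| <= `|a| * `|b| ;
  cnorm_star : forall a, `|cmul (cstar a) a| = `|a| ^+ 2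
}.

Notation "a ** b" := (cmul a b) (at level 40, left associativity) : ring_scope.

Section Groupoid.
Context {X : topologicalType} (phi : X -> X).

Definition in_gpd (g : X * int * X) : Prop :=
  exists a b : nat,
    g.1.2 = a%:Z - b%:Z /\ iter a phi g.1.1 = iter b phi g.2.

Record gpd := Gpd { gval :> X * int * X ; gvalP : `[< in_gpd gval >] }.

HB.instance Definition _ := [isSub for gval].
HB.instance Definition _ := [Choice of gpd by <:].

Definition grng (g : gpd) : X := (gval g).1.1.
Definition gdeg (g : gpd) : int := (gval g).1.2.
Definition gsrc (g : gpd) : X := (gval g).2.

Fact gunit_subproof (x : X) : `[< in_gpd (x, 0, x) >].
Proof. by apply/asboolP; exists 0%N, 0%N. Qed.

Definition gunit (x : X) : gpd := Gpd (gunit_subproof x).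

Fact ginv_subproof (g : gpd) : `[< in_gpd (gsrc g, - gdeg g, grng g) >].
Proof.
case: g => g; rewrite /gsrc /gdeg /grng /= => /asboolP[a [b [ek eab]]].
by apply/asboolP; exists b, a; split; rewrite //= ek opprB.
Qed.

Definition ginv (g : gpd) : gpd := Gpd (ginv_subproof g).

(* [is_gmul g1 g2 g]: g1 and g2 are composable with product g *)
Definition is_gmul (g1 g2 g : gpd) : Prop :=
  gsrc g1 = grng g2 /\ gval g = (grng g1, gdeg g1 + gdeg g2, gsrc g2).

(* Used only when 0 <= n + k, in which case [k + i] is nonnegative for i >= n
   and the absolute value merely casts it to nat. *)
Definition gpd_level (k : int) (n : nat) : set gpd :=
  [set g | gdeg g = k /\
    forall i : nat, (n <= i)%N ->
      iter (absz (k + i%:Z)) phi (grng g) = iter i phi (gsrc g)].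

(* The degree is constant on Gamma_phi(k, n), so the relative topology from
   X * Z * X (Z discrete) is the one from X * X. A set is open in the disjoint
   union of the inductive limits iff its trace on each level is relatively
   open. *)
Definition gpd_open : set_system gpd :=
  [set U | forall (k : int) (n : nat), 0 <= n%:Z + k ->
    exists2 O : set (X * X), open O &
      U `&` gpd_level k n =
      [set g | O (grng g, gsrc g)] `&` gpd_level k n].

Fact gpd_openT : gpd_open setT.
Proof. by move=> k n _; exists setT; [exact: openT|rewrite !setTI]. Qed.

Fact gpd_openI : setI_closed gpd_open.
Proof.
move=> U V oU oV k n kn.
have [W oW eW] := oU k n kn; have [Z oZ eZ] := oV k n kn.
exists (W `&` Z); first exact: openI.
have -> : [set g | (W `&` Z) (grng g, gsrc g)] =
    [set g | W (grng g, gsrc g)] `&` [set g | Z (grng g, gsrc g)] by [].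
by rewrite -[gpd_level k n]setIid setIACA eW eZ setIACA.
Qed.

Fact gpd_open_bigU (I : Type) (f : I -> set gpd) :
  (forall i, gpd_open (f i)) -> gpd_open (\bigcup_i f i).
Proof.
move=> of_ k n kn.
have /choice[W HW] : forall i, exists W : set (X * X), open W /\
    f i `&` gpd_level k n = [set g | W (grng g, gsrc g)] `&` gpd_level k n.
  by move=> i; have [W oW eW] := of_ i k n kn; exists W.
exists (\bigcup_i W i); first by apply: bigcup_open => i _; exact: (HW i).1.
rewrite setI_bigcupl; apply/seteqP; split => g.
  by move=> [i _]; rewrite (HW i).2 => -[Wg lg]; split=> //; exists i.
by move=> [[i _ Wg] lg]; exists i => //; rewrite (HW i).2.
Qed.

HB.instance Definition _ :=
  isOpenTopological.Build gpd gpd_openT gpd_openI gpd_open_bigU.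

End Groupoid.

Section ReducedNorm.
Context {R : realType} {X : topologicalType} (phi : X -> X).

Notation fn := (gpd phi -> R[i]).

(* Finitely supported sum: for f in alg* Gamma_phi only finitely many terms are
   nonzero, f having finite support on each fiber of the range map. *)
Definition conv (f g : fn) : fn := fun c =>
  \sum_(p \in [set p : gpd phi * gpd phi | is_gmul p.1 p.2 c])
    (f p.1 * g p.2).

Definition invol (f : fn) : fn := fun c => (f (ginv c))^*.

Definition cts_cpt_supp (f : gpd phi -> (R[i] : numFieldType)) : Prop :=
  continuous f /\ compact (closure [set c | f c != 0]).

Inductive alg_star : set fn :=
| alg_star_cc f of cts_cpt_supp f : alg_star f
| alg_star_add f g of alg_star f & alg_star g : alg_star (fun c => f c + g c)
| alg_star_scale (z : R[i]) f of alg_star f : alg_star (fun c => z * f c)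
| alg_star_conv f g of alg_star f & alg_star g : alg_star (conv f g)
| alg_star_invol f of alg_star f : alg_star (invol f).

Definition l2norm (xi : fn) : \bar R :=
  sqrte (\esum_(c in [set: gpd phi]) ((complex.Re `|xi c|) ^+ 2)%:E)%E.

(* Vectors of l^2({c | gsrc c = x}) are extended by 0 to the whole groupoid;
   then pi_x(f) xi is [conv f xi], again supported on that fiber. *)
Definition rep_norm (x : X) (f : fn) : \bar R :=
  ereal_sup [set l2norm (conv f xi) | xi in
    [set xi : fn | (forall c, gsrc c <> x -> xi c = 0) /\
                   (l2norm xi <= 1)%E]].

Definition reduced_norm (f : fn) : \bar R :=
  ereal_sup [set rep_norm x f | x in [set: X]].

Definition unit_supported (f : fn) : Prop :=
  forall c, f c != 0 -> exists x, c = gunit phi x.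

(* m(x) = # phi^{-1}(phi(x)) *)
Definition fiber_card (x : X) : nat := #|` fset_set (phi @^-1` [set phi x])|.

Definition Vfun : fn := fun c =>
  if (gdeg c == 1) && (gsrc c == phi (grng c))
  then ((Num.sqrt (fiber_card (grng c))%:R)^-1)%:C else 0.

End ReducedNorm.

Section ReducedAlgebra.
Context {R : realType} {X : topologicalType} {phi : X -> X}.
Context {A : cstarAlg R} (iota : (gpd phi -> R[i]) -> A).

(* A is the completion of alg* Gamma_phi in the reduced norm, with canonical
   map iota; the values of iota outside alg* Gamma_phi are irrelevant. *)
Record is_reduced_cstar : Prop := {
  iotaD : forall f g, alg_star f -> alg_star g ->
    iota (fun c => f c + g c) = iota f + iota g ;
  iotaZ : forall (z : R[i]) f, alg_star f ->
    iota (fun c => z * f c) = z *: iota f ;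
  iotaM : forall f g, alg_star f -> alg_star g ->
    iota (conv f g) = iota f ** iota g ;
  iota_star : forall f, alg_star f -> iota (invol f) = cstar (iota f) ;
  iota_norm : forall f, alg_star f -> (rnorm (iota f))%:E = reduced_norm f ;
  iota_dense : closure (iota @` (@alg_star R X phi)) = [set: A]
}.

Definition Dalg : set A :=
  closure (iota @` [set f | alg_star f /\ unit_supported f]).

(* [Dfun d h]: d belongs to [Dalg] and h is the bounded function on X
   identified with d. *)
Definition Dfun (d : A) (h : X -> R[i]) : Prop :=
  forall e : R, 0 < e -> exists f : gpd phi -> R[i],
    [/\ alg_star f, unit_supported f, rnorm (d - iota f) < e &
        forall x, complex.Re `|h x - f (gunit phi x)| < e].

Definition in_D (F : X -> R) : Prop :=
  exists d : A, Dfun d (fun x => (F x)%:C).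

(* Vfun belongs to alg* Gamma_phi: the function m takes finitely many values. *)
Definition Visom : A := iota (@Vfun R X phi).

Definition expi (t : R) : R[i] := cos t +i* sin t.

Record is_action (alpha : R -> A -> A) : Prop := {
  actionD : forall t, {morph alpha t : a b / a + b} ;
  actionZ : forall t (z : R[i]) a, alpha t (z *: a) = z *: alpha t a ;
  actionM : forall t, {morph alpha t : a b / a ** b} ;
  action_star : forall t a, alpha t (cstar a) = cstar (alpha t a) ;
  action0 : forall a, alpha 0 a = a ;
  action_add : forall s t a, alpha (s + t) a = alpha s (alpha t a) ;
  action_continuous : forall a, continuous (alpha ^~ a)
}.

Record is_action_of (F : X -> R) (alpha : R -> A -> A) : Prop := {
  is_action_of_action : is_action alpha ;
  action_Dalg : forall t d, Dalg d -> alpha t d = d ;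
  action_Visom : forall t, exists2 u : A,
    Dfun u (fun x => expi (t * F x)) & alpha t Visom = u ** Visom
}.

End ReducedAlgebra.

Section KMS.
Context {R : realType} {A : cstarAlg R}.

Definition is_state (omega : {scalar A}) : Prop :=
  (forall a, 0 <= omega (cstar a ** a)) /\
  ereal_sup [set (complex.Re `|omega a|)%:E | a in [set a : A | `|a| <= 1]]
    = 1%E.

(* f is an entire A-valued extension of t |-> alpha_t(a); it is unique, and
   alpha_z(a) stands for f z. *)
Definition analytic_extension (alpha : R -> A -> A) (a : A)
    (f : (R[i] : numFieldType) -> A) : Prop :=
  (forall z, derivable f z 1) /\ (forall t : R, f t%:C = alpha t a).

Definition is_analytic (alpha : R -> A -> A) (a : A) : Prop :=
  exists f, analytic_extension alpha a f.

Definition is_KMS_state (alpha : R -> A -> A) (beta : R)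
    (omega : {scalar A}) : Prop :=
  is_state omega /\
  forall (a b : A) (f : R[i] -> A),
    analytic_extension alpha a f -> is_analytic alpha b ->
    omega (a ** b) = omega (b ** f (0 +i* beta)).

End KMS.

Section Dynamics.
Context {R : realType} {X : topologicalType} (phi : X -> X).

Definition locally_injective : Prop :=
  exists2 B : set (set X), basis B &
    forall U, B U -> {in U &, injective phi}.

Definition birkhoff_sum (H : X -> R) (k : nat) (x : X) : R :=
  \sum_(j < k) H (iter j phi x).

Definition lower_mean (H : X -> R) : R :=
  lim ((fun k : nat => k%:R^-1 * inf (range (birkhoff_sum H k))) @ \oo).

Definition upper_mean (H : X -> R) : R :=
  lim ((fun k : nat => k%:R^-1 * sup (range (birkhoff_sum H k))) @ \oo).

Definition preim_card (n : nat) (x : X) : nat :=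
  #|` fset_set (iter n phi @^-1` [set x])|.

(* The supremum of this bounded set of integers is its maximum. *)
Definition h_m : R :=
  lim ((fun n : nat =>
    n%:R^-1 * ln (sup [set (preim_card n x)%:R | x in [set: X]])) @ \oo).

Definition log_m (x : X) : R := ln (fiber_card phi x)%:R.

End Dynamics.

(* Main.v *)
From Pilot Require Import Defs.
From HB Require Import structures.
From mathcomp Require Import all_boot all_order all_algebra.
From mathcomp Require Import finmap.
From mathcomp Require Import all_classical all_reals all_analysis.
From mathcomp Require Import complex.
From mathcomp Require Import ring lra.
(* [convex] also exports a [conv]. *)
Import Pilot.Defs.
Import Order.TTheory GRing.Theory Num.Theory.
Import numFieldNormedType.Exports.
Local Open Scope classical_set_scope.
Local Open Scope ring_scope.
Local Open Scope complex_scope.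

Set Implicit Arguments.
Unset Strict Implicit.
Unset Printing Implicit Defensive.

(** Let [L g x] be the sum of [g] over the fiber of [x] under phi, and let [T] be
    the indicator of the graph of phi in the groupoid, so that [alpha_t T] is
    [e^(itF) T] and [T^* d T = L d] for [d] in [D]. If [h] is continuous and phi
    is injective on its support, then [(h T)(h T)^* = h^2]; the KMS condition for
    [h T] and [(h T)^* d] therefore reads [omega (h^2 d) = omega (L (e^(-beta F)
    h^2 d))]. Summing over a partition of unity gives [omega d =
    omega (L (e^(-beta F) d))] on [D], and by iteration
    [1 = omega (L^n (e^(-S_n (beta F))))]. As [omega] is a state, [1] lies between
    any pointwise bounds of [L^n (e^(-S_n (beta F)))]; comparing this function
    with [L^n 1 x = # phi^-n x] and with [L^n (e^(-S_n (log m))) = 1] yields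
    [inf S_n (beta F) <= log max # phi^-n] and
    [inf S_n (log m) <= sup S_n (beta F)]. *)

(** * Means of subadditive sequences *)

(** The fiber sizes of phi may jump, so L need not preserve continuity. All computations therefore
    take place in D, through [Dfun], which is isometric for the supremum norm and closed under
    products, uniform limits, exponentials and L. The operator T is preferred to V_phi for two
    reasons: it is a continuous function, the graph of phi being clopen and compact in the groupoid,
    and T^* d T is an unweighted sum over fibers. The action is prescribed on V_phi only; it is
    carried over to T by T = V_phi d, where d in D is the square root of L 1 and hence is fixed.

    The product T T^* lives on all pairs with phi x = phi y and is in general not diagonal; the
    cut-off h removes the pairs with x <> y. Evaluation at time i beta requires e^(izF) for every
    complex z, as a norm-differentiable family in D.

    The state is compared with constants through its norm and its value at the unit, so no square
    roots are taken in D. Since beta and F enter only through the potential beta F, the sign of beta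
    matters only when beta is pulled out of the means. *)

Section Fekete.
Context {R : realType}.

(** The limit is the infimum of u n / n over n >= 1. If q = u p / p nearly attains it, then u n - n
    q does not increase when n grows by p, so it is bounded above in terms of its first p values. *)
Lemma fekete (u : nat -> R) (C : R) :
  (forall m n, u (m + n)%N <= u m + u n) -> (forall n, - (C * n%:R) <= u n) ->
  cvg ((fun n => n%:R^-1 * u n) @ \oo).
Proof.
move=> sub lb.
pose E := [set n.+1%:R^-1 * u n.+1 | n in [set: nat]].
have infE : has_inf E.
  split; first by exists (1%:R^-1 * u 1%N); exists 0%N.
  exists (- C) => _ [n _ <-].
  by rewrite ler_pdivlMl// mulrN mulrC lb.
apply/cvg_ex; exists (inf E); apply/cvgrPdist_le => e e0.
have [_ [N _ <-]] := inf_adherent (divr_gt0 e0 (ltr0Sn R 1)) infE.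
set q := _ * _ => Nq.
have uq : u N.+1 = N.+1%:R * q by rewrite mulrA divff ?mul1r// pnatr_eq0.
pose v n := u n - n%:R * q.
(* The sum of absolute values dominates each of the first N + 1 values of v. *)
pose B := \sum_(r < N.+1) `|v r|.
have vB n : v n <= B.
  elim/ltn_ind: n => n IH; have [nN|Nn] := ltnP n N.+1.
    rewrite /B (bigD1 (Ordinal nN))//=.
    by rewrite ler_wpDr ?sumr_ge0// ler_norm.
  have := IH (n - N.+1)%N; rewrite ltn_subrL (leq_trans _ Nn)// => /(_ isT).
  apply: le_trans; have := sub (n - N.+1)%N N.+1; rewrite subnK// uq /v.
  by rewrite natrB// mulrBl; lra.
have B0 : 0 <= B by exact: sumr_ge0.
near=> n.
have n0 : (0 < n)%N by near: n; exists 1%N.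
have n0r : 0 < n%:R :> R by rewrite ltr0n.
have l1 : inf E <= n%:R^-1 * u n.
  apply: ge_inf; first exact: infE.2.
  by exists n.-1; rewrite // prednK.
rewrite ler0_norm ?subr_le0// opprB lerBlDl ler_pdivrMl//.
have l2 : B <= n%:R * (e / 2).
  rewrite -ler_pdivrMr ?divr_gt0//; near: n; exact: nbhs_infty_ger.
have := vB n; rewrite /v => l3.
have l4 : n%:R * q <= n%:R * (inf E + e / 2) by rewrite ler_wpM2l// ltW.
by rewrite mulrDr in l4 *; lra.
Unshelve. all: by end_near. Qed.

Lemma sup_scale (E : set R) (a : R) : 0 < a -> has_sup E ->
  sup [set a * x | x in E] = a * sup E.
Proof.
move=> a0 [[x0 Ex0] [M HM]].
have sE : has_sup E by split; [exists x0|exists M].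
apply/eqP; rewrite eq_le; apply/andP; split.
  apply: ge_sup; first by exists (a * x0), x0.
  by move=> _ [x Ex <-]; rewrite ler_pM2l// ub_le_sup//; exists M.
rewrite -ler_pdivlMl//; apply: ge_sup; first by exists x0.
move=> x Ex; rewrite ler_pdivlMl//; apply: ub_le_sup; last by exists x.
by exists (a * M) => _ [y Ey <-]; rewrite ler_pM2l// HM.
Qed.

End Fekete.

Section Means.
Context {R : realType} {X : topologicalType} (phi : X -> X).
Hypothesis X0 : [set: X] !=set0.

Lemma birkhoff_bounded (H : X -> R) (M : R) n x : (forall y, `|H y| <= M) ->
  `|birkhoff_sum phi H n x| <= M * n%:R.
Proof.
move=> HM; rewrite (le_trans (ler_norm_sum _ _ _))//.
rewrite (le_trans (ler_sum _ (fun i _ => HM _)))//.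
by rewrite sumr_const card_ord mulr_natr.
Qed.

Lemma birkhoff_has_sup (H : X -> R) (M : R) n : (forall y, `|H y| <= M) ->
  has_sup (range (birkhoff_sum phi H n)).
Proof.
move=> HM; have [x0 _] := X0; split; first by exists (birkhoff_sum phi H n x0), x0.
exists (M * n%:R) => _ [x _ <-].
by rewrite (le_trans (ler_norm _))// birkhoff_bounded.
Qed.

Lemma birkhoff_has_inf (H : X -> R) (M : R) n : (forall y, `|H y| <= M) ->
  has_inf (range (birkhoff_sum phi H n)).
Proof.
move=> HM; have [x0 _] := X0; split; first by exists (birkhoff_sum phi H n x0), x0.
exists (- (M * n%:R)) => _ [x _ <-].
by have := birkhoff_bounded n x HM; rewrite ler_norml => /andP[].
Qed.

Lemma birkhoffZ (a : R) (H : X -> R) n x :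
  birkhoff_sum phi (fun y => a * H y) n x = a * birkhoff_sum phi H n x.
Proof. by rewrite /birkhoff_sum mulr_sumr. Qed.

Lemma birkhoffN (H : X -> R) n x :
  birkhoff_sum phi (fun y => - H y) n x = - birkhoff_sum phi H n x.
Proof. by rewrite /birkhoff_sum sumrN. Qed.

Lemma birkhoffD (H : X -> R) m n x : birkhoff_sum phi H (m + n) x =
  birkhoff_sum phi H m x + birkhoff_sum phi H n (iter m phi x).
Proof.
rewrite /birkhoff_sum big_split_ord /=; congr (_ + _).
by apply: eq_bigr => i _; rewrite addnC iterD.
Qed.

(** The cocycle identity [birkhoffD] makes the suprema subadditive. *)
Lemma upper_mean_cvg (H : X -> R) (M : R) : (forall y, `|H y| <= M) ->
  cvg ((fun k : nat => k%:R^-1 * sup (range (birkhoff_sum phi H k))) @ \oo).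
Proof.
move=> HM; apply: (@fekete _ _ M) => [m n|n].
  apply: ge_sup; first by have [] := birkhoff_has_sup (m + n) HM.
  move=> _ [x _ <-]; rewrite birkhoffD; apply: lerD; apply: sup_upper_bound.
  - exact: birkhoff_has_sup HM.
  - by exists x.
  - exact: birkhoff_has_sup HM.
  - by exists (iter m phi x).
have [x0 _] := X0.
apply: (@le_trans _ _ (birkhoff_sum phi H n x0)).
  by have := birkhoff_bounded n x0 HM; rewrite ler_norml => /andP[].
by apply: sup_upper_bound; [exact: birkhoff_has_sup HM|exists x0].
Qed.

Lemma birkhoff_infE (H : X -> R) n :
  inf (range (birkhoff_sum phi H n)) =
  - sup (range (birkhoff_sum phi (fun y => - H y) n)).
Proof.
rewrite /inf image_comp; congr (- sup _).
by apply: eq_imagel => x _ /=; rewrite birkhoffN.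
Qed.

Lemma lower_meanE (H : X -> R) (M : R) : (forall y, `|H y| <= M) ->
  cvg ((fun k : nat => k%:R^-1 * inf (range (birkhoff_sum phi H k))) @ \oo) /\
  lower_mean phi H = - upper_mean phi (fun y => - H y).
Proof.
move=> HM; have HN y : `|- H y| <= M by rewrite normrN.
have := upper_mean_cvg HN => cN.
rewrite /lower_mean /upper_mean.
under eq_fun do rewrite birkhoff_infE mulrN.
by split; [exact: is_cvgN|exact: limN].
Qed.

(** A negative factor a is treated as - a times the function - H, with [lower_meanE] exchanging the
    two means. *)
Lemma upper_meanZ (a : R) (H : X -> R) (M : R) : 0 < a -> (forall y, `|H y| <= M) ->
  upper_mean phi (fun y => a * H y) = a * upper_mean phi H.
Proof.
move=> a0 HM; apply: cvg_lim; first exact: Rhausdorff.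
have -> : (fun k : nat => k%:R^-1 * sup (range (birkhoff_sum phi (fun y => a * H y) k))) =
    (fun k : nat => a * (k%:R^-1 * sup (range (birkhoff_sum phi H k)))).
  apply/funext => n; rewrite mulrCA -(sup_scale a0 (birkhoff_has_sup n HM)).
  congr (_ * sup _); rewrite image_comp; apply: eq_imagel => x _ /=.
  exact: birkhoffZ.
by apply: cvgM; [exact: cvg_cst|exact: upper_mean_cvg HM].
Qed.

End Means.

(** * The complex exponential *)

Section CplxNorm.
Context {R : realType}.
Implicit Types (w z : R[i]) (x : R).

Definition cabs w : R := complex.Re `|w|.

Lemma cabsE w : `|w| = (cabs w)%:C.
Proof. by rewrite /cabs; case: w => a b; rewrite normc_def. Qed.

Lemma cabs_def w : cabs w = Num.sqrt (complex.Re w ^+ 2 + complex.Im w ^+ 2).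
Proof. by case: w => a b; rewrite /cabs normc_def. Qed.

Lemma cabs_ge0 w : 0 <= cabs w.
Proof. by rewrite cabs_def sqrtr_ge0. Qed.

Lemma cabsM w z : cabs (w * z) = cabs w * cabs z.
Proof. by rewrite {1}/cabs normrM !cabsE -rmorphM. Qed.

Lemma cabsD w z : cabs (w + z) <= cabs w + cabs z.
Proof. by have := ler_normD w z; rewrite !cabsE -rmorphD /= lecR. Qed.

Lemma cabsN w : cabs (- w) = cabs w.
Proof. by rewrite /cabs normrN. Qed.

Lemma cabs_real x : cabs x%:C = `|x|.
Proof. by rewrite cabs_def /= expr0n addr0 sqrtr_sqr. Qed.

Lemma cabs_conj w : cabs w^* = cabs w.
Proof. by rewrite !cabs_def; case: w => a b /=; rewrite sqrrN. Qed.

Lemma cabs0_eq0 w : cabs w = 0 -> w = 0.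
Proof. by move=> w0; apply/eqP; rewrite -normr_eq0 cabsE w0. Qed.

Lemma cabs_Re w : `|complex.Re w| <= cabs w.
Proof.
rewrite cabs_def -sqrtr_sqr ler_wsqrtr// lerDl sqr_ge0//.
Qed.

Lemma cabs_Im w : `|complex.Im w| <= cabs w.
Proof. by rewrite cabs_def -sqrtr_sqr ler_wsqrtr// lerDr sqr_ge0. Qed.

Lemma cabs_le w : cabs w <= `|complex.Re w| + `|complex.Im w|.
Proof.
rewrite cabs_def -[leRHS]ger0_norm ?addr_ge0// -sqrtr_sqr ler_wsqrtr//.
rewrite sqrrD !real_normK ?num_real// -addrA lerD2l lerDr.
by rewrite mulrn_wge0// mulr_ge0.
Qed.

End CplxNorm.

Section Cexp.
Context {R : realType}.
Implicit Types (w z : R[i]) (x p q : R).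

(** Built from [expi], so that at imaginary arguments it reduces to the multiplier in
    [is_action_of]. *)
Definition cexp w : R[i] := (expR (complex.Re w))%:C * expi (complex.Im w).

Lemma expiD x y : expi (x + y) = expi x * expi y :> R[i].
Proof. by rewrite /expi sinD cosD; simpc; congr (_ +i* _); ring. Qed.

Lemma cexpD w z : cexp (w + z) = cexp w * cexp z.
Proof.
rewrite /cexp; case: w z => [a b] [c d] /=.
by rewrite expRD expiD rmorphM /=; ring.
Qed.

(** The resulting bound |sin q| <= |q| gives [cos_lb] by the half-angle formula; [sin_est] then
    compares the factor cos c with 1. *)
Lemma sin_mvt q : exists2 c, `|c| <= `|q| & sin q = cos c * q.
Proof.
wlog q0 : q / 0 <= q.
  move=> H; have [q0|/ltW q0] := leP 0 q; first exact: H.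
  have [|c c1 c2] := H (- q); first by rewrite oppr_ge0.
  by exists c; [rewrite -(normrN q)|rewrite -[q in sin q]opprK sinN c2 mulrN opprK].
have dsin x : x \in `]0, q[ -> is_derive x 1 sin (cos x) by move=> _; exact: is_derive_sin.
have csin : {within `[0, q], continuous (@sin R)}.
  by apply: continuous_subspaceT => x; exact: continuous_sin.
have [c] := MVT_segment q0 dsin csin.
rewrite in_itv /= sin0 !subr0 => /andP[c0 cq] ->; exists c => //.
by rewrite !ger0_norm.
Qed.

Lemma cos_lb q : 1 - q ^+ 2 / 2 <= cos q.
Proof.
have [c _ e] := sin_mvt (q / 2).
have : sin (q / 2) ^+ 2 <= (q / 2) ^+ 2.
  by rewrite e exprMn ler_piMl ?sqr_ge0//.
have -> : cos q = 1 - 2 * sin (q / 2) ^+ 2.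
  rewrite {1}(splitr q) -mulr2n cos_mulr2n cos2sin2; ring.
by rewrite expr_div_n => h; lra.
Qed.

Lemma sin_est q : `|q| <= 1 -> `|sin q - q| <= q ^+ 2.
Proof.
move=> q1; have [c cq ->] := sin_mvt q.
rewrite (_ : cos c * q - q = (cos c - 1) * q); last by ring.
have c2 : c ^+ 2 <= q ^+ 2 by rewrite -(real_normK (num_real c)) -(real_normK (num_real q)) ler_sqr.
have := cos_lb c; have := cos_le1 c => h1 h2.
rewrite normrM ler0_norm ?subr_le0// opprB -(real_normK (num_real q)) expr2.
rewrite ler_wpM2r//.
have : `|q| * `|q| <= `|q| * 1 by rewrite ler_wpM2l.
by rewrite -expr2 real_normK ?num_real// mulr1 => h3; lra.
Qed.

(** The difference is nonnegative since 1 + p <= e^p. The upper bound comes from 1 - p <= e^(-p),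
    that is (1 - p) e^p <= 1, after multiplication by 1 - p > 0. *)
Lemma expR_est p : `|p| <= 1 / 2 -> `|expR p - 1 - p| <= 2 * p ^+ 2.
Proof.
rewrite ler_norml => /andP[p1 p2].
have h1 := expR_ge1Dx p; have h2 := expR_ge1Dx (- p).
rewrite ger0_norm; last by move=> *; lra.
have e0 := expR_gt0 p.
have : (1 - p) * expR p <= 1.
  by have := ler_wpM2l (ltW e0) h2; rewrite expRxMexpNx_1 mulrC.
move=> h3; have : (1 - p) * (expR p - 1 - p - 2 * p ^+ 2) <= 0.
  have : (1 - p) * (expR p - 1 - p - 2 * p ^+ 2) =
      (1 - p) * expR p - 1 - p ^+ 2 * (1 - 2 * p).
    ring.
  move=> ->; have : 0 <= p ^+ 2 * (1 - 2 * p) by rewrite mulr_ge0 ?sqr_ge0//; lra.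
  by move=> *; lra.
by rewrite pmulr_rle0; lra.
Qed.

(** The constant is 3 + 4, from the real and the imaginary part. Its uniformity in w is what turns
    scalar differentiability into norm differentiability in D. *)
Lemma cexp_est w : cabs w <= 1 / 2 -> cabs (cexp w - 1 - w) <= 7 * cabs w ^+ 2.
Proof.
move=> w2; set r := cabs w.
have pr := cabs_Re w; have qr := cabs_Im w; rewrite -/r in pr qr w2.
rewrite (le_trans (cabs_le _))//.
move: pr qr; rewrite /cexp /expi; case: w @r w2 => p q r w2 /= pr qr.
rewrite !(mul0r, subr0, addr0, oppr0, add0r).
have r0 : 0 <= r by apply: le_trans pr.
have p2 : `|p| <= 1 / 2 by apply: le_trans w2.
have q2 : `|q| <= 1 by move=> *; lra.
have E1 := expR_est p2; have S1 := sin_est q2; have C1 := cos_lb q; have C2 := cos_le1 q.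
have eb : expR p <= 2 by move: p2 E1; rewrite !ler_norml => /andP[? ?] /andP[? ?]; nra.
have e0 := expR_gt0 p.
have pp : p ^+ 2 <= r ^+ 2 by rewrite -(real_normK (num_real p)) ler_sqr.
have qq : q ^+ 2 <= r ^+ 2 by rewrite -(real_normK (num_real q)) ler_sqr.
have A1 : `|expR p * cos q - 1 - p| <= 3 * r ^+ 2.
  rewrite (_ : _ - p = (expR p - 1 - p) + expR p * (cos q - 1)); last by ring.
  rewrite (le_trans (ler_normD _ _))// normrM (ger0_norm (ltW e0)).
  rewrite (ler0_norm (_ : cos q - 1 <= 0)) ?subr_le0//.
  have : expR p * - (cos q - 1) <= 2 * (q ^+ 2 / 2) by apply: ler_pM => //; lra.
  by move=> *; lra.
have A2 : `|expR p * sin q - q| <= 4 * r ^+ 2.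
  rewrite (_ : _ - q = expR p * (sin q - q) + q * (expR p - 1)); last by ring.
  rewrite (le_trans (ler_normD _ _))// !normrM (ger0_norm (ltW e0)).
  have : expR p * `|sin q - q| <= 2 * q ^+ 2 by apply: ler_pM => //; lra.
  have : `|expR p - 1| <= 2 * r.
    have -> : expR p - 1 = (expR p - 1 - p) + p by ring.
    rewrite (le_trans (ler_normD _ _))//.
    have : r ^+ 2 <= r * (1 / 2) by rewrite expr2 ler_wpM2l.
    by move=> *; lra.
  move=> h; have : `|q| * `|expR p - 1| <= r * (2 * r) by apply: ler_pM.
  by rewrite [r * (2 * r)]mulrCA -expr2; lra.
by move=> *; lra.
Qed.

(** The remainder at p is dominated termwise by the remainder at M, so the order found at M serves
    for all p. *)
Lemma expR_taylor_unif (M e : R) : 0 <= M -> 0 < e -> exists n : nat, forall p,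
  `|p| <= M -> `|expR p - \sum_(k < n) p ^+ k / k`!%:R| <= e.
Proof.
move=> M0 e0.
have cM := is_cvg_series_exp_coeff M.
have [n _ Hn] : \forall n \near \oo, `|expR M - series (exp_coeff M) n| < e.
  by move/cvgrPdist_lt : cM; exact.
exists n => p pM.
have Sp m : \sum_(k < m) p ^+ k / k`!%:R = series (exp_coeff p) m.
  by rewrite /series /= big_mkord.
rewrite Sp -[expR p]/(limn (series (exp_coeff p))).
have le d : `|series (exp_coeff p) (n + d) - series (exp_coeff p) n| <= e.
  have sD x : series (exp_coeff x) (n + d) - series (exp_coeff x) n =
      \sum_(i < d) exp_coeff x (n + i)%N.
    by rewrite /series /= !big_mkord big_split_ord /= addrAC subrr add0r.
  rewrite sD (le_trans (ler_norm_sum _ _ _))//.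
  apply: (@le_trans _ _ (series (exp_coeff M) (n + d) - series (exp_coeff M) n)).
    rewrite sD; apply: ler_sum => i _.
    rewrite /exp_coeff /= normrM normrX normfV normr_nat ler_wpM2r ?invr_ge0//.
    by rewrite lerXn2r// nnegrE.
  have : series (exp_coeff M) (n + d) <= expR M.
    apply: nondecreasing_cvgn_le => //; apply: nondecreasing_series => k _ _.
    by rewrite /exp_coeff /= divr_ge0// exprn_ge0.
  have := Hn n (leqnn n); rewrite ltr_norml => /andP[_ h1] h2; lra.
have cp : series (exp_coeff p) @ \oo --> limn (series (exp_coeff p)).
  exact: is_cvg_series_exp_coeff.
have c2 : (fun N => `|series (exp_coeff p) N - series (exp_coeff p) n|) @ \oo -->
    `|limn (series (exp_coeff p)) - series (exp_coeff p) n|.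
  by apply: cvg_norm; apply: cvgB => //; exact: cvg_cst.
rewrite -(cvg_lim _ c2); last exact: Rhausdorff.
apply: limr_le; first by apply/cvg_ex; eexists; exact: c2.
by exists n => // N /= nN; rewrite -(subnKC nN).
Qed.

End Cexp.

(** * Convolution on the groupoid *)

Section Convolution.
Context {R : realType} {X : topologicalType} (phi : X -> X).

Notation fn := (gpd phi -> R[i]).

Fact garrow_subproof (k : nat) (x : X) : `[< in_gpd phi (x, k%:Z, iter k phi x) >].
Proof. by apply/asboolP; exists k, 0%N; rewrite subr0. Qed.

Definition garrow (k : nat) (x : X) : gpd phi := Gpd (garrow_subproof k x).

(** The function h carried by the graph of phi^k: [sect 0 h] is h on the unit space,
    [sect 1 (fun=> 1)] is T, and [Vfun] has the form [sect 1 h] with h = m^(-1/2). *)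
Definition sect (k : nat) (h : X -> R[i]) : fn := fun c =>
  if (gdeg c == k%:Z) && (gsrc c == iter k phi (grng c)) then h (grng c) else 0.

Lemma gpd_eq (c d : gpd phi) :
  grng c = grng d -> gdeg c = gdeg d -> gsrc c = gsrc d -> c = d.
Proof.
move=> h1 h2 h3; apply: val_inj; move: h1 h2 h3.
by rewrite /grng /gdeg /gsrc /=; case: c d => [[[? ?] ?] ?] [[[? ?] ?] ?] /= -> -> ->.
Qed.

Lemma is_gmulP (p q c : gpd phi) : is_gmul p q c <->
  [/\ gsrc p = grng q, grng c = grng p, gdeg c = gdeg p + gdeg q & gsrc c = gsrc q].
Proof.
rewrite /is_gmul /grng /gdeg /gsrc; split=> [[-> ->]//|[-> h1 h2 h3]].
by split=> //; move: h1 h2 h3; case: (gval c) => [[? ?] ?] /= -> -> ->.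
Qed.

Lemma sect_neq0 k (h : X -> R[i]) c : sect k h c != 0 -> c = garrow k (grng c).
Proof.
rewrite /sect; case: ifP => [/andP[/eqP d /eqP s] _|_]; last by rewrite eqxx.
exact: gpd_eq.
Qed.

Lemma sect_arrow k (h : X -> R[i]) x : sect k h (garrow k x) = h x.
Proof. by rewrite /sect /gdeg /gsrc /grng /= !eqxx. Qed.

Lemma ginvK (c : gpd phi) : ginv (ginv c) = c.
Proof. by apply: gpd_eq; rewrite // /gdeg /= opprK. Qed.

Lemma invol_sect_neq0 k (h : X -> R[i]) c :
  invol (sect k h) c != 0 -> c = ginv (garrow k (gsrc c)).
Proof.
by rewrite /invol conjc_eq0 => /sect_neq0 /(congr1 (@ginv _ phi)); rewrite ginvK.
Qed.

Lemma invol_sect_arrow k (h : X -> R[i]) x :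
  invol (sect k h) (ginv (garrow k x)) = (h x)^*.
Proof.
by rewrite /invol ginvK sect_arrow. Qed.

(** An arrow may have infinitely many factorizations; for factors carried by graphs only a few
    contribute, and the sum is evaluated on those. *)
Lemma conv_supp (f g : fn) c (P : set (gpd phi * gpd phi)) :
  P `<=` [set p | is_gmul p.1 p.2 c] ->
  (forall p, is_gmul p.1 p.2 c -> f p.1 != 0 -> g p.2 != 0 -> P p) ->
  conv f g c = \sum_(p \in P) (f p.1 * g p.2).
Proof.
move=> sP HP; apply/esym/fsbig_widen => // p [pc nP].
apply/eqP; rewrite mulf_eq0; apply/negPn/negP; rewrite negb_or => /andP[h1 h2].
by apply: nP; exact: HP.
Qed.

Lemma conv_supp1 (f g : fn) c (p : gpd phi * gpd phi) : is_gmul p.1 p.2 c ->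
  (forall q, is_gmul q.1 q.2 c -> f q.1 != 0 -> g q.2 != 0 -> q = p) ->
  conv f g c = f p.1 * g p.2.
Proof.
move=> pc H; rewrite (@conv_supp f g c [set p]) ?fsbig_set1//.
by move=> q ->.
Qed.

Lemma conv_supp0 (f g : fn) c :
  (forall q, is_gmul q.1 q.2 c -> f q.1 != 0 -> g q.2 != 0 -> False) ->
  conv f g c = 0.
Proof. by move=> H; rewrite (@conv_supp f g c set0) ?fsbig_set0. Qed.

Lemma conv_unitl (h : X -> R[i]) (f : fn) c :
  conv (sect 0 h) f c = h (grng c) * f c.
Proof.
rewrite (@conv_supp1 _ _ _ (garrow 0 (grng c), c)) /= ?sect_arrow//.
  by apply/is_gmulP; split; rewrite // /gdeg /= add0r.
case=> p q /= /is_gmulP[h1 h2 h3 h4] /sect_neq0 ep _.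
have e2 : grng c = grng q by rewrite h2 -h1 ep.
congr (_, _); first by rewrite ep h2.
by apply: gpd_eq; rewrite // h3 ep /gdeg /= add0r.
Qed.

Lemma conv_unitr (h : X -> R[i]) (f : fn) c :
  conv f (sect 0 h) c = f c * h (gsrc c).
Proof.
rewrite (@conv_supp1 _ _ _ (c, garrow 0 (gsrc c))) /= ?sect_arrow//.
  by apply/is_gmulP; split; rewrite // /gdeg /= addr0.
case=> p q /= /is_gmulP[h1 h2 h3 h4] _ /sect_neq0 eq_.
have e2 : gsrc c = gsrc p by rewrite h4 h1 eq_.
congr (_, _); last by rewrite eq_ -h1 e2.
by apply: gpd_eq; rewrite // h3 eq_ /gdeg /= addr0.
Qed.

Lemma unit_conv_sect k (g h : X -> R[i]) :
  conv (sect 0 g) (sect k h) = sect k (fun x => g x * h x).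
Proof.
apply/funext => c; rewrite conv_unitl /sect; case: ifP => // _.
by rewrite mulr0.
Qed.

Lemma sect_conv_unit k (g h : X -> R[i]) :
  conv (sect k h) (sect 0 g) = sect k (fun x => h x * g (iter k phi x)).
Proof.
apply/funext => c; rewrite conv_unitr /sect; case: ifP => [/andP[_ /eqP ->]//|_].
by rewrite mul0r.
Qed.

Lemma invol_unit (h : X -> R[i]) :
  invol (sect 0 h) = sect 0 (fun x => (h x)^*).
Proof.
apply/funext => c; rewrite /invol /sect.
have -> : gdeg (ginv c) = - gdeg c by [].
have -> : gsrc (ginv c) = grng c by [].
have -> : grng (ginv c) = gsrc c by [].
rewrite /= oppr_eq0 [grng c == _]eq_sym.
case: ifP => [/andP[_ /eqP ->]//|_]; exact: (@conjc0 R).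
Qed.

(** A factorization goes forward from x to phi^k x and back to some y with the same image; the
    injectivity hypothesis leaves y = x only, so the product is diagonal. *)
Lemma conv_sect_invol k (g h : X -> R[i]) :
  (forall x y, g x != 0 -> h y != 0 -> iter k phi x = iter k phi y -> x = y) ->
  conv (sect k g) (invol (sect k h)) = sect 0 (fun x => g x * (h x)^*).
Proof.
move=> inj; apply/funext => c.
have [e|/eqP nc] := eqVneq c (garrow 0 (grng c)).
  move: (grng c) e => x ->.
  rewrite (@conv_supp1 _ _ _ (garrow k x, ginv (garrow k x))) /=.
  - by rewrite !sect_arrow invol_sect_arrow.
  - by apply/is_gmulP; split; rewrite // /gdeg /= subrr.
  - case=> p q /= /is_gmulP[h1 h2 h3 h4] /sect_neq0 ep /invol_sect_neq0 eq_.
    by rewrite ep eq_ -h4 -h2.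
rewrite (@conv_supp0 (sect k g)).
  by apply/esym/eqP/negPn/negP => /sect_neq0.
case=> p q /= /is_gmulP[h1 h2 h3 h4] p0 q0.
have ep := sect_neq0 p0; have eq_ := invol_sect_neq0 q0.
apply: nc; move: h1 p0 q0; rewrite ep eq_ sect_arrow invol_sect_arrow conjc_eq0.
rewrite /gsrc /= => h1 p0 q0.
have e2 := inj _ _ p0 q0 h1.
apply: gpd_eq => //; first by rewrite h3 ep eq_ /gdeg /= subrr.
by rewrite h4 h2.
Qed.

(** Here a factorization goes back from x to a point y of its fiber and forward again, so it always
    ends at x, with one term for each y. For k = 1 this is the origin of L. *)
Lemma conv_invol_sect k (g h : X -> R[i]) :
  (forall x, finite_set (iter k phi @^-1` [set x])) ->
  conv (invol (sect k g)) (sect k h) = sect 0 (fun x =>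
    \sum_(y <- fset_set (iter k phi @^-1` [set x])) (g y)^* * h y).
Proof.
move=> fin; apply/funext => c.
have [e|/eqP nc] := eqVneq c (garrow 0 (grng c)); last first.
  rewrite (@conv_supp0 (invol (sect k g))).
    by apply/esym/eqP/negPn/negP => /sect_neq0.
  case=> p q /= /is_gmulP[h1 h2 h3 h4] /invol_sect_neq0 ep /sect_neq0 eq_.
  apply: nc; apply: gpd_eq => //; first by rewrite h3 ep eq_ /gdeg /= addNr.
  by rewrite h4 eq_ h2 ep -h1.
move: (grng c) e => x ->.
rewrite sect_arrow -fsbig_finite//.
pose j y := (ginv (garrow k y), garrow k y).
have jinj : set_inj (iter k phi @^-1` [set x]) j.
  by move=> ? ? _ _ [].
rewrite (@conv_supp _ _ _ (j @` (iter k phi @^-1` [set x]))).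
- rewrite fsbig_image//; apply: eq_fsbigr => y _ /=.
  by rewrite invol_sect_arrow sect_arrow.
- move=> _ [y /= ey <-]; apply/is_gmulP; split => //=.
  by rewrite /gdeg /= addNr.
- case=> p q /= /is_gmulP[h1 h2 h3 h4] /invol_sect_neq0 ep /sect_neq0 eq_.
  exists (gsrc p); last by rewrite /j -ep h1 -eq_.
  by transitivity (grng p); [rewrite [in RHS]ep|rewrite -h2].
Qed.

End Convolution.

Arguments sect {R X} phi k h c.
Arguments garrow {X} phi k x.

(** * Topology of the groupoid and continuity of sections over graphs *)

Lemma open_preimage (Y Z : topologicalType) (f : Y -> Z) (O : set Z) :
  continuous f -> open O -> open (f @^-1` O).
Proof. by move=> /continuousP; exact. Qed.

Lemma open_setX (Y Z : topologicalType) (A : set Y) (B : set Z) :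
  open A -> open B -> open (A `*` B).
Proof.
move=> oA oB; have -> : A `*` B = fst @^-1` A `&` snd @^-1` B by [].
by apply: openI; apply: open_preimage => // p; [exact: cvg_fst|exact: cvg_snd].
Qed.

Section Topology.
Context {R : realType} {X : topologicalType} (phi : X -> X).
Hypotheses (X_hausdorff : hausdorff_space X) (X_compact : compact [set: X]).
Hypotheses (phi_cont : continuous phi) (phi_locinj : locally_injective phi).

Definition arrows (k : nat) : set (gpd phi) :=
  [set c | gdeg c = k%:Z /\ gsrc c = iter k phi (grng c)].

Lemma iter_continuous (k : nat) : continuous (iter k phi).
Proof.
elim: k => [|k IH] x; first exact: cvg_id.
by apply: (@continuous_comp _ _ _ (iter k phi) phi); [exact: IH|exact: phi_cont].
Qed.

Lemma gpd_openE (U : set (gpd phi)) : open U = gpd_open U.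
Proof. by []. Qed.

Lemma open_offdiagonal : open [set p : X * X | p.1 <> p.2].
Proof.
pose I := [set AB : set X * set X | [/\ open AB.1, open AB.2 & AB.1 `&` AB.2 = set0]].
have -> : [set p : X * X | p.1 <> p.2] = \bigcup_(AB in I) (AB.1 `*` AB.2).
  apply/seteqP; split => [[x y] /= /eqP xy|[x y] [[A B] [_ _ AB] [/= Ax By]] xy].
    have := X_hausdorff; rewrite open_hausdorff => /(_ _ _ xy)[[A B] /= [Ax By] [oA oB /eqP AB]].
    by exists (A, B) => //; split; exact: set_mem.
  by have : (A `&` B) x; [split => //; rewrite xy|rewrite AB].
by apply: bigcup_open => -[A B] [oA oB _]; exact: open_setX.
Qed.

(** An arrow of level n from x to y only guarantees phi^(k+i) x = phi^i y for i >= n. It lies on the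
    graph of phi^k exactly when, for every i < n, these two points share a basis set on which phi is
    injective, and this is an open condition. *)
Lemma arrows_open k : open (arrows k).
Proof.
rewrite gpd_openE => k' n _.
have [kk|kk] := eqVneq k' k%:Z; last first.
  exists set0; first exact: open0.
  apply/seteqP; split => [c [[h1 _] [h2 _]]|c []//].
  by move: kk; rewrite -h1 -h2 eqxx.
subst k'.
have [B [Bo Bb] Bi] := phi_locinj.
pose W0 := [set p : X * X | exists2 U, B U & U p.1 /\ U p.2].
have W0o : open W0.
  have -> : W0 = \bigcup_(U in B) (U `*` U).
    by apply/seteqP; split => [p [U BU [? ?]]|p [U BU [? ?]]]; exists U.
  by apply: bigcup_open => U BU; apply: open_setX; exact: Bo.
pose it i (p : X * X) := (iter i phi (iter k phi p.1), iter i phi p.2).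
have itc i : continuous (it i).
  move=> p; apply: cvg_pair => /=.
    apply: (@continuous_comp _ _ _ fst (fun y => iter i phi (iter k phi y))).
      exact: cvg_fst.
    by apply: (@continuous_comp _ _ _ (iter k phi) (iter i phi)); exact: iter_continuous.
  apply: (@continuous_comp _ _ _ snd (iter i phi)); first exact: cvg_snd.
  exact: iter_continuous.
have kE i : absz (k%:Z + i%:Z) = (i + k)%N by rewrite -PoszD absz_nat addnC.
have oW m : open (\bigcap_(i in `I_m) (it i @^-1` W0)).
  elim: m => [|m IH]; first by rewrite II0 bigcap_set0; exact: openT.
  rewrite IIS bigcap_setU bigcap_set1; apply: openI => //.
  exact: open_preimage.
exists (\bigcap_(i in `I_n) (it i @^-1` W0)) => //.
apply/seteqP; split => c.
  move=> [[h1 h2] h3]; split => // i _ /=.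
  have [U [BU Ux] _] := Bb (iter i phi (iter k phi (grng c))) setT (@filterT _ (nbhs _) _).
  by exists U => //=; rewrite h2.
move=> [cW h3]; split => //; split; first by case: h3.
(* local injectivity descends the agreement from time n to time 0 *)
have H j : (j <= n)%N -> iter (n - j) phi (iter k phi (grng c)) = iter (n - j) phi (gsrc c).
  elim: j => [|j IH] jn.
    by case: h3 => _ /(_ n); rewrite leqnn kE subn0 iterD => ->.
  have := IH (ltnW jn); rewrite -(subnSK jn) !iterS => e.
  have : (n - j.+1 < n)%N by rewrite ltn_subrL /= (leq_ltn_trans _ jn).
  move=> /cW -[U BU /= [u1 u2]].
  by apply: (Bi U BU); rewrite ?inE.
by have := H n (leqnn n); rewrite subnn.
Qed.

Lemma arrows_closed k : closed (arrows k).
Proof.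
rewrite -openC gpd_openE => k' n _.
have [kk|kk] := eqVneq k' k%:Z; last first.
  exists setT; first exact: openT.
  apply/seteqP; split => [c [_ h]//|c [_ h]]; split => // -[h1 _].
  by case: h => h2 _; move: kk; rewrite -h1 -h2 eqxx.
subst k'.
exists [set p : X * X | iter k phi p.1 <> p.2].
  pose f (p : X * X) := (iter k phi p.1, p.2).
  have fc : continuous f.
    move=> p; apply: cvg_pair => /=; last exact: cvg_snd.
    apply: (@continuous_comp _ _ _ fst (iter k phi)) => /=; first exact: cvg_fst.
    exact: iter_continuous.
  have -> : [set p : X * X | iter k phi p.1 <> p.2] = f @^-1` [set p | p.1 <> p.2].
    by apply/seteqP; split.
  apply: open_preimage => //; exact: open_offdiagonal.
apply/seteqP; split => c [h1 h2]; split => //.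
  by move=> e; apply: h1; split => //; case: h2.
by move=> [_ e]; apply: h1.
Qed.

Lemma grng_continuous : continuous (@grng X phi).
Proof.
apply/continuousP => O oO; rewrite gpd_openE => k n _.
exists (fst @^-1` O) => //; apply: open_preimage => // p; exact: cvg_fst.
Qed.

(** All these arrows lie in level 0, so a single trace of an open set decides. *)
Lemma garrow_continuous k : continuous (garrow phi k).
Proof.
apply/continuousP => O; rewrite gpd_openE => /(_ k%:Z 0%N) [//|W oW eW].
have -> : garrow phi k @^-1` O = (fun x => (x, iter k phi x)) @^-1` W.
  have lv x : @gpd_level _ phi k%:Z 0 (garrow phi k x).
    split => // i _; rewrite -PoszD absz_nat addnC iterD.
    by rewrite /grng /gsrc.
  apply/seteqP; split => x /= h.
    suff : (O `&` @gpd_level _ phi k%:Z 0) (garrow phi k x) by rewrite eW => -[].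
    by [].
  suff : ([set g | W (grng g, gsrc g)] `&` @gpd_level _ phi k%:Z 0) (garrow phi k x).
    by rewrite -eW => -[].
  by [].
apply: open_preimage => // x; apply: cvg_pair => /=; first exact: cvg_id.
exact: iter_continuous.
Qed.

Lemma arrows_compact k : compact (arrows k).
Proof.
have -> : arrows k = garrow phi k @` setT.
  apply/seteqP; split => [c [h1 h2]|_ [x _ <-]]; last by split.
  by exists (grng c) => //; apply: gpd_eq.
apply: continuous_compact => //; apply: continuous_subspaceT.
exact: garrow_continuous.
Qed.

(** The graph is clopen and compact, so extension by zero preserves continuity and the support is
    compact. *)
Lemma sect_cts k (h : X -> (R[i] : numFieldType)) : continuous h ->
  cts_cpt_supp (sect phi k h).
Proof.
move=> hc; split; last first.
  apply: (@subclosed_compact _ _ (arrows k)); first exact: closed_closure.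
    exact: arrows_compact.
  have E := (closure_id (arrows k)).1 (arrows_closed (k:=k)).
  by rewrite [X in _ `<=` X]E; apply: closure_subset => c /= /sect_neq0 ->.
apply/continuousP => O oO.
have -> : sect phi k h @^-1` O = (arrows k `&` (h \o @grng X phi) @^-1` O)
    `|` (~` arrows k `&` [set c | O 0]).
  rewrite /sect; apply/seteqP; split => c /=.
    case: ifP => [/andP[/eqP ? /eqP ?]|/negP h1] Oc; [left|right] => //.
    by split => // -[/eqP h2 /eqP h3]; apply: h1; rewrite h2.
  case=> -[]; first by move=> [-> ->]; rewrite !eqxx.
  by case: ifP => // /andP[/eqP ? /eqP ?] [].
apply: openU; apply: openI.
- exact: arrows_open.
- apply: open_preimage => // c; apply: continuous_comp; last exact: hc.
  exact: grng_continuous.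
- by rewrite openC; exact: arrows_closed.
- have [h0|h0] := pselect (O 0).
    have -> : [set _ : gpd phi | O 0] = setT by apply/seteqP; split.
    exact: openT.
  have -> : [set _ : gpd phi | O 0] = set0 by apply/seteqP; split.
    exact: open0.
Qed.

End Topology.

(** * Fibers and the transfer operator *)

Lemma finite_open_cover (X : topologicalType) (I : choiceType) (f : I -> set X) :
  compact [set: X] -> (forall i, open (f i)) -> (forall x, exists i, f i x) ->
  exists D : {fset I}, forall x, exists2 i, i \in D & f i x.
Proof.
(* [compact_cover] concerns pointed spaces, so a point of X is fixed; an empty X is covered by the
   empty family. *)
move=> cX of_ cov; have [[x0]|X0] := pselect (exists x : X, True); last first.
  by exists fset0 => x; case: X0; exists x.
pose Xp : ptopologicalType := HB.pack X (isPointed.Build X x0).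
have : @cover_compact Xp [set: X] by rewrite -compact_cover.
move=> /(_ I setT f)[|x _|D _ HD]; first by move=> i _; exact: of_.
  by have [i fi] := cov x; exists i.
by exists D => x; have [i Di fi] := HD x Logic.I; exists i.
Qed.

Lemma mdist_continuous (R : realType) (X : metricType R) (x : X) :
  continuous (mdist x : X -> R).
Proof.
move=> y; apply/cvgrPdist_lt => e e0.
near=> z.
have d : mdist y z < e.
  by near: z; apply/nbhs_ballP; exists e => // z; rewrite ballEmdist.
rewrite ltr_distlC; have := metric_triangle x y z; have := metric_triangle x z y.
rewrite (metric_sym z y) => h1 h2; apply/andP; split; lra.
Unshelve. all: by end_near. Qed.

Section Fibers.
Context {R : realType} {X : metricType R} (phi : X -> X).
Hypotheses (X_compact : compact [set: X]) (phi_locinj : locally_injective phi).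

(** Tent functions that are nonzero exactly on balls where phi is injective. They serve twice: to
    bound the fiber sizes and, squared and normalized, as the partition of unity of [KMS_ruelle]. *)
Lemma locinj_bumps : exists (D : {fset X}) (f : X -> X -> R),
  [/\ forall x, continuous (f x),
      forall x y z, f x y != 0 -> f x z != 0 -> phi y = phi z -> y = z &
      forall y, exists2 x, x \in D & f x y != 0].
Proof.
have [B [Bo Bb] Bi] := phi_locinj.
have /choice[r Hr] : forall x : X, exists r : R, 0 < r /\
    forall y z, mdist x y < r -> mdist x z < r -> phi y = phi z -> y = z.
  move=> x; have [U [BU Ux] _] := Bb x setT (@filterT _ (nbhs _) _).
  have /nbhs_ballP[r r0 rU] : nbhs x U by apply: open_nbhs_nbhs; split=> //; exact: Bo.
  exists r; split => // y z xy xz.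
  by apply: (Bi U BU); rewrite inE; apply: rU; rewrite ballEmdist.
pose f x y : R := Num.max 0 (r x - mdist x y).
have f0 x y : (f x y != 0) = (mdist x y < r x).
  rewrite /f; case: ltP => h; last by rewrite max_l ?eqxx// subr_le0.
  by rewrite max_r ?subr_ge0 ?(ltW h)// gt_eqF// subr_gt0.
have fc x : continuous (f x).
  move=> y; apply: (@continuous_max _ _ (cst 0) (fun y => r x - mdist x y)).
    exact: cvg_cst.
  apply: cvgB; [exact: cvg_cst|exact: mdist_continuous].
have [||D HD] := @finite_open_cover X X (fun x => [set y | f x y != 0]) X_compact.
- by move=> x; exact: (open_preimage (fc x) (@open_neq _ 0)).
- by move=> x; exists x; rewrite /= f0 mdistxx (Hr x).1.
exists D, f; split => //.
by move=> x y z; rewrite !f0; exact: (Hr x).2.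
Qed.

(** Each of the finitely many balls contains at most one point of a given fiber, so the number of
    balls bounds every fiber. *)
Lemma fiber_finite_bounded : (forall x, finite_set (phi @^-1` [set x])) /\
  exists K : nat, forall x, (#|` fset_set (phi @^-1` [set x])| <= K)%N.
Proof.
have [D [f [_ finj fcov]]] := locinj_bumps.
have fin x : finite_set (phi @^-1` [set x]).
  apply: (@sub_finite_set _ _ (\bigcup_(z in [set` D]) [set y | f z y != 0 /\ phi y = x])).
    by move=> y /= e; have [z zD fz] := fcov y; exists z.
  apply: bigcup_finite => // z _.
  have [[y [y1 y2]]|n] := pselect (exists y, f z y != 0 /\ phi y = x).
    apply: (@sub_finite_set _ _ [set y]) => // t [t1 t2].
    by apply: (finj z) => //; rewrite y2.
  by rewrite (_ : [set _ | _] = set0)//; apply/seteqP; split => // t h; apply: n; exists t.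
split => //; exists #|` D|%N => x.
have /choice[g Hg] : forall y, exists z, z \in D /\ f z y != 0.
  by move=> y; have [z ? ?] := fcov y; exists z.
set S := fset_set _; have <- : #|` [fset g y | y in S]%fset| = #|` S|.
  rewrite card_in_imfset//= => y z; rewrite !in_fset_set// !inE /= => ey ez eg.
  by apply: (finj (g y)); [exact: (Hg y).2|rewrite eg; exact: (Hg z).2|rewrite ey ez].
apply: fsubset_leq_card; apply/fsubsetP => _ /imfsetP[y _ ->]; exact: (Hg y).1.
Qed.

End Fibers.

(** The operator L, over any [zmodType] so that it applies both to real weights, where inequalities
    are proved, and to the complex functions of D. *)
Definition transfer (X : choiceType) (phi : X -> X) (V : zmodType) (h : X -> V)
    (x : X) : V :=
  \sum_(y <- fset_set (phi @^-1` [set x])) h y.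

Arguments transfer {X} phi {V} h x.

Section Transfer.
Context {X : choiceType} (phi : X -> X).
Hypothesis fin : forall x, finite_set (phi @^-1` [set x]).

Lemma iter_fiber_finite n x : finite_set (iter n phi @^-1` [set x]).
Proof.
elim: n x => [|n IH] x; first exact: (finite_set1 x).
have -> : iter n.+1 phi @^-1` [set x] =
    \bigcup_(y in phi @^-1` [set x]) (iter n phi @^-1` [set y]).
  by apply/seteqP; split => [z /= e|z [y /= <- <-]//]; exists (iter n phi z).
exact: bigcup_finite.
Qed.


Lemma transfer_iter (V : zmodType) n (h : X -> V) x :
  iter n (transfer phi) h x =
  \sum_(y <- fset_set (iter n phi @^-1` [set x])) h y.
Proof.
have finn := iter_fiber_finite.
elim: n h x => [|n IH] h x.
  have -> : iter 0 phi @^-1` [set x] = [set x] by [].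
  by rewrite fset_set1 big_seq_fset1.
rewrite iterSr IH.
set Z := fset_set _; set Y := fset_set _.
(* The points y of the longer fiber are grouped by z = phi y. *)
transitivity (\sum_(y <- Y) \sum_(z <- Z | z == phi y) h y); last first.
  rewrite big_seq [RHS]big_seq; apply: eq_bigr => y yY.
  have yZ : phi y \in Z.
    move: yY; rewrite /Y /Z !in_fset_set// !inE => /= <-.
    by rewrite -[RHS]iterS iterSr.
  exact: (@fbig_pred1_inj _ _ _ _ _ (fun=> h y) id _ _ yZ).
rewrite (exchange_big_dep xpredT)//= big_seq [RHS]big_seq.
apply: eq_bigr => z zZ; rewrite /transfer -[RHS]big_filter.
apply: perm_big; apply: uniq_perm; rewrite ?filter_uniq ?fset_uniq// => y.
rewrite mem_filter /Y !in_fset_set//.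
move: zZ; rewrite /Z in_fset_set// inE /= => zZ.
apply/idP/andP => [|[/eqP zy _]]; rewrite !inE //= => yz; split; first by rewrite yz.
by rewrite -iterS iterSr yz.
Qed.

End Transfer.

Section TransferReal.
Context {R : realType} {X : choiceType} (phi : X -> X).

Lemma transfer_le (g h : X -> R) : (forall x, g x <= h x) ->
  forall x, transfer phi g x <= transfer phi h x.
Proof. by move=> gh x; apply: ler_sum. Qed.

Lemma transfer_iter_le n (g h : X -> R) : (forall x, g x <= h x) ->
  forall x, iter n (transfer phi) g x <= iter n (transfer phi) h x.
Proof. by move=> gh; elim: n => //= n IH; exact: transfer_le. Qed.

Lemma transferMr (K : comPzRingType) (g h : X -> K) :
  (forall x, finite_set (phi @^-1` [set x])) ->
  transfer phi (fun y => g (phi y) * h y) = fun x => g x * transfer phi h x.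
Proof.
move=> fin; apply/funext => x; rewrite /transfer mulr_sumr !big_seq.
by apply: eq_bigr => y; rewrite in_fset_set// inE => /= ->.
Qed.

Lemma transferZ_iter (K : comPzRingType) n (a : K) (h : X -> K) :
  iter n (transfer phi) (fun y => a * h y) = fun x => a * iter n (transfer phi) h x.
Proof.
elim: n h => //= n IH h; rewrite IH; apply/funext => x.
by rewrite /transfer mulr_sumr.
Qed.

(** Moving a weight inside L composes it with phi ([transferMr]), so the iterates collect the
    product of w along orbits. *)
Lemma transfer_weight (K : comPzRingType) (w : X -> K) n (h : X -> K) :
  (forall x, finite_set (phi @^-1` [set x])) ->
  iter n (fun g => transfer phi (fun y => w y * g y)) h =
  iter n (transfer phi) (fun y => (\prod_(j < n) w (iter j phi y)) * h y).
Proof.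
move=> fin; elim: n h => [|n IH] h.
  by apply/funext => x /=; rewrite big_ord0 mul1r.
rewrite iterSr IH iterSr; congr (iter _ _ _).
rewrite -(transferMr (fun y => \prod_(j < n) w (iter j phi y)))//.
congr (transfer _ _); apply/funext => y; rewrite big_ord_recl /= mulrCA mulrA.
by congr (_ * _ * _); apply: eq_bigr => i _; rewrite -iterSr.
Qed.

End TransferReal.

(** * Preimage counts and the passage to growth rates *)

Section Dynamics.
Context {R : realType} {X : metricType R} (phi : X -> X).
Hypotheses (X0 : [set: X] !=set0) (X_compact : compact [set: X]).
Hypothesis phi_locinj : locally_injective phi.
Hypothesis phi_surj : forall y : X, exists x : X, phi x = y.

Let fin : forall x, finite_set (phi @^-1` [set x]) :=
  (fiber_finite_bounded X_compact phi_locinj).1.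

Lemma preim_cardE n x : (preim_card phi n x)%:R = iter n (transfer phi) (fun=> 1) x :> R.
Proof. by rewrite transfer_iter// big_const_seq count_predT iter_addr_0. Qed.

Lemma preim_card_ge1 n x : 1 <= (preim_card phi n x)%:R :> R.
Proof.
have [y yx] : exists y, iter n phi y = x.
  elim: n x => [|n IH] x; first by exists x.
  have [y <-] := phi_surj x; have [z <-] := IH y; by exists z.
rewrite ler1n cardfs_gt0; apply/fset0Pn; exists y.
by rewrite in_fset_set ?inE//; exact: iter_fiber_finite.
Qed.

Definition max_preim (n : nat) : R := sup [set (preim_card phi n x)%:R | x in [set: X]].

Lemma preim_has_sup n : has_sup [set ((preim_card phi n x)%:R : R) | x in [set: X]].
Proof.
have [x0 _] := X0; split; first by exists (preim_card phi n x0)%:R, x0.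
have [K HK] := (fiber_finite_bounded X_compact phi_locinj).2.
exists (K%:R ^+ n) => _ [x _ <-]; rewrite preim_cardE.
elim: n x => [|n IH] x; first by rewrite expr0.
rewrite iterS; apply: (@le_trans _ _ (transfer phi (fun=> K%:R ^+ n) x)).
  exact: transfer_le.
rewrite /transfer big_const_seq count_predT iter_addr_0 -[leLHS]mulr_natl exprS.
by rewrite ler_wpM2r ?exprn_ge0// ler_nat; exact: HK.
Qed.

Lemma preim_le_max n x : (preim_card phi n x)%:R <= max_preim n.
Proof. by apply: sup_upper_bound; [exact: preim_has_sup|exists x]. Qed.

Lemma max_preim_ge1 n : 1 <= max_preim n.
Proof. by have [x0 _] := X0; exact: le_trans (preim_card_ge1 n x0) (preim_le_max n x0). Qed.

Lemma max_preimD m n : max_preim (m + n) <= max_preim m * max_preim n.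
Proof.
apply: ge_sup; first by have [] := preim_has_sup (m + n).
move=> _ [x _ <-]; rewrite preim_cardE iterD.
apply: (@le_trans _ _ (iter m (transfer phi) (fun y => max_preim n * 1) x)).
  by apply: transfer_iter_le => y; rewrite mulr1 -preim_cardE preim_le_max.
rewrite transferZ_iter -preim_cardE mulrC ler_wpM2r ?preim_le_max//.
exact: le_trans (max_preim_ge1 n).
Qed.

(** The maxima are submultiplicative, and at least 1 because phi is surjective; hence their
    logarithms are subadditive and nonnegative. *)
Lemma h_m_cvg : cvg ((fun n : nat => n%:R^-1 * ln (max_preim n)) @ \oo).
Proof.
have p n : 0 < max_preim n by exact: lt_le_trans (max_preim_ge1 n).
apply: (@fekete _ _ 0) => [m n|n]; last by rewrite mul0r oppr0 ln_ge0// max_preim_ge1.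
by rewrite -lnM ?posrE// ler_ln ?posrE ?mulr_gt0// max_preimD.
Qed.

Lemma fiber_card_ge1 x : 1 <= (fiber_card phi x)%:R :> R.
Proof. exact: (preim_card_ge1 1 (phi x)). Qed.

Lemma log_m_bounded : exists M : R, forall x, `|log_m phi x| <= M.
Proof.
have [K HK] := (fiber_finite_bounded X_compact phi_locinj).2.
exists (ln K%:R) => x; rewrite /log_m ger0_norm ?ln_ge0 ?fiber_card_ge1//.
have f0 : 0 < (fiber_card phi x)%:R :> R by exact: lt_le_trans (fiber_card_ge1 x).
have fK : (fiber_card phi x)%:R <= K%:R :> R by rewrite ler_nat; exact: HK.
by rewrite ler_ln// posrE// (lt_le_trans f0).
Qed.

Lemma expR_birkhoff (H : X -> R) n y :
  expR (- birkhoff_sum phi H n y) = \prod_(j < n) expR (- H (iter j phi y)).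
Proof. by rewrite /birkhoff_sum -sumrN expR_sum. Qed.

(** The weight 1 / m is constant on the fiber over x, equal to the inverse of the size of this
    fiber. So the operator with this weight fixes 1, and [transfer_weight] expands its n-th
    iterate. *)
Lemma transfer_log_m n :
  iter n (transfer phi) (fun y => expR (- birkhoff_sum phi (log_m phi) n y)) =
  (fun=> 1 : R).
Proof.
pose w y : R := expR (- log_m phi y).
transitivity (iter n (fun g => transfer phi (fun y => w y * g y)) (fun=> 1)).
  rewrite transfer_weight//; congr iter; apply/funext => y.
  by rewrite expR_birkhoff mulr1.
elim: n => //= n ->; apply/funext => x.
have c0 : 0 < (preim_card phi 1 x)%:R :> R by exact: lt_le_trans (preim_card_ge1 1 x).
transitivity (\sum_(y <- fset_set (phi @^-1` [set x])) ((preim_card phi 1 x)%:R^-1 : R)).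
  rewrite /transfer big_seq [RHS]big_seq; apply: eq_bigr => y.
  rewrite in_fset_set// inE /= => yx; rewrite /w /log_m mulr1 expRN.
  rewrite lnK ?posrE; last exact: lt_le_trans (fiber_card_ge1 y).
  by rewrite /fiber_card yx.
rewrite big_const_seq count_predT iter_addr_0 -[LHS]mulr_natl mulfV//.
by rewrite gt_eqF.
Qed.

(** The hypothesis on c and C is all that is retained of the KMS state; it will be used with G =
    beta F. *)
Lemma mean_inequalities (G : X -> R) (M : R) : (forall x, `|G x| <= M) ->
  (forall n (c C : R), 0 <= c ->
    (forall x, c <= iter n (transfer phi) (fun y => expR (- birkhoff_sum phi G n y)) x <= C) ->
    c <= 1 <= C) ->
  lower_mean phi (log_m phi) <= upper_mean phi G /\ lower_mean phi G <= h_m phi.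
Proof.
move=> GM key; have [L HL] := log_m_bounded.
have bS n := birkhoff_has_sup phi X0 n GM.
have bI n := birkhoff_has_inf phi X0 n GM.
have bL n := birkhoff_has_inf phi X0 n HL.
have infle (E : X -> R) (n : nat) x : has_inf (range (birkhoff_sum phi E n)) ->
    inf (range (birkhoff_sum phi E n)) <= birkhoff_sum phi E n x.
  by move=> h; apply: ge_inf; [exact: h.2|exists x].
have supge n x : birkhoff_sum phi G n x <= sup (range (birkhoff_sum phi G n)).
  by apply: sup_upper_bound; [exact: bS|exists x].
have bound n :
    inf (range (birkhoff_sum phi (log_m phi) n)) <= sup (range (birkhoff_sum phi G n)) /\
    inf (range (birkhoff_sum phi G n)) <= ln (max_preim n).
  set iL := inf (range (birkhoff_sum phi (log_m phi) n)).
  set sG := sup (range (birkhoff_sum phi G n)); set iG := inf (range (birkhoff_sum phi G n)).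
  have p0 : 0 < max_preim n by exact: lt_le_trans (max_preim_ge1 n).
  (* Below, e^(-S_n G) >= e^(-sG) >= e^(iL - sG) e^(-S_n (log m)), and L^n sends the last
     exponential to 1. Above, e^(-S_n G) <= e^(-iG), and L^n 1 is at most [max_preim n]. *)
  have /andP[k1 k2] : expR (iL - sG) <= 1 <= expR (- iG) * max_preim n.
    apply: (key n _ _ (expR_ge0 _)) => x; apply/andP; split.
      apply: (@le_trans _ _ (iter n (transfer phi) (fun y =>
          expR (iL - sG) * expR (- birkhoff_sum phi (log_m phi) n y)) x)).
        by rewrite transferZ_iter transfer_log_m mulr1.
      apply: transfer_iter_le => y; rewrite -expRD ler_expR.
      have := infle _ n y (bL n); have := supge n y; rewrite -/iL -/sG => *; lra.
    apply: (@le_trans _ _ (iter n (transfer phi) (fun=> expR (- iG) * 1) x)).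
      apply: transfer_iter_le => y; rewrite mulr1 ler_expR lerN2.
      exact: infle.
    by rewrite transferZ_iter -preim_cardE ler_wpM2l ?expR_ge0// preim_le_max.
  split.
    by rewrite -subr_le0 -ler_expR expR0.
  rewrite -[iG]expRK ler_ln ?posrE ?expR_gt0//.
  by move: k2; rewrite expRN ler_pdivlMl ?expR_gt0// mulr1.
have [cL _] := lower_meanE phi X0 HL; have [cG _] := lower_meanE phi X0 GM.
have cU := upper_mean_cvg (phi:=phi) X0 GM.
by split; apply: ler_lim => //; [|exact: h_m_cvg|];
  near=> n; rewrite ler_wpM2l ?invr_ge0//; have [] := bound n.
Unshelve. all: by end_near. Qed.

End Dynamics.

(** * The diagonal subalgebra *)

Section UnitNorm.
Context {R : realType} {X : topologicalType} (phi : X -> X).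
Implicit Types (h : X -> R[i]) (xi : gpd phi -> R[i]).

Lemma l2norm_le xi (C : R) : 0 <= C -> (l2norm xi <= C%:E)%E =
  (\esum_(c in [set: gpd phi]) ((cabs (xi c)) ^+ 2)%:E <= (C ^+ 2)%:E)%E.
Proof.
move=> C0; rewrite -[in RHS]lee_sqrt ?lee_fin ?sqr_ge0//.
by rewrite /sqrte sqrtr_sqr ger0_norm.
Qed.

(** A function on the unit space acts on each l^2 space as multiplication by its value at the
    range. *)
Lemma reduced_norm_unit_le h (C : R) : 0 <= C -> (forall x, cabs (h x) <= C) ->
  (reduced_norm (sect phi 0 h) <= C%:E)%E.
Proof.
move=> C0 hC; apply: ge_ereal_sup => _ [x _ <-].
apply: ge_ereal_sup => _ [xi [_ xi1] <-].
rewrite l2norm_le//; move: xi1; rewrite l2norm_le// => xi1.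
apply: ge_ereal_sup => _ [S [finS _] <-].
rewrite fsbig_finite// sumEFin lee_fin.
apply: (@le_trans _ _ (C ^+ 2 * \sum_(c <- fset_set S) cabs (xi c) ^+ 2)).
  rewrite mulr_sumr; apply: ler_sum => c _.
  rewrite conv_unitl cabsM exprMn ler_wpM2r ?sqr_ge0//.
  by rewrite lerXn2r ?nnegrE// cabs_ge0.
rewrite ler_piMr ?sqr_ge0// -lee_fin.
rewrite expr1n in xi1; apply: le_trans xi1.
apply: esum_ge; exists S; first by split.
by rewrite fsbig_finite// sumEFin.
Qed.

(** The test vector is the point mass at the unit x. *)
Lemma reduced_norm_unit_ge h x :
  ((cabs (h x))%:E <= reduced_norm (sect phi 0 h))%E.
Proof.
pose xi : gpd phi -> R[i] := fun c => if c == garrow phi 0 x then 1 else 0.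
(* The factor a is h x for the image of xi, and 1 for xi itself. *)
have sq (a : R[i]) :
    \esum_(c in [set: gpd phi]) ((cabs (a * xi c)) ^+ 2)%:E = ((cabs a) ^+ 2)%:E.
  rewrite -(@esum_set1 _ _ (garrow phi 0 x) (fun=> ((cabs a) ^+ 2)%:E))//; last first.
    by rewrite lee_fin sqr_ge0.
  rewrite [RHS]esum_mkcond; apply: eq_esum => c _.
  rewrite /xi; case: eqP => [->|n]; first by rewrite mem_set// mulr1.
  by rewrite memNset// mulr0 (cabs_real 0) normr0 expr0n.
apply: (@le_trans _ _ (rep_norm x (sect phi 0 h))); last first.
  by apply: ereal_sup_ubound; exists x.
apply: (@le_trans _ _ (l2norm (conv (sect phi 0 h) xi))).
  rewrite /l2norm.
  have -> : conv (sect phi 0 h) xi = fun c => h x * xi c.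
    apply/funext => c; rewrite conv_unitl /xi; case: eqP => [->//|_].
    by rewrite !mulr0.
  by rewrite sq /sqrte sqrtr_sqr ger0_norm// cabs_ge0.
apply: ereal_sup_ubound; exists xi => //; split.
  by move=> c; rewrite /xi; case: eqP => // ->.
have e1 : cabs (1 : R[i]) = 1 by rewrite (cabs_real 1) normr1.
rewrite l2norm_le// -[X in (_ <= (X ^+ _)%:E)%E]e1 -sq.
by rewrite le_eqVlt; apply/orP; left; apply/eqP/eq_esum => c _; rewrite mul1r.
Qed.

End UnitNorm.

Section NormedC.
Context {R : realType} {V : normedModType R[i]}.
Implicit Types (a b : V).

Lemma rnormE a : `|a| = (rnorm a)%:C.
Proof.
have := normr_ge0 a; rewrite /rnorm; case: `|a| => x y.
by rewrite lecE /= => /andP[/eqP -> _].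
Qed.

Lemma rnorm_ge0 a : 0 <= rnorm a.
Proof. by have := normr_ge0 a; rewrite rnormE lecR. Qed.

Lemma rnormD a b : rnorm (a + b) <= rnorm a + rnorm b.
Proof. by have := ler_normD a b; rewrite !rnormE -rmorphD /= lecR. Qed.

Lemma rnormN a : rnorm (- a) = rnorm a.
Proof. by rewrite /rnorm normrN. Qed.

Lemma rnormB a b : rnorm (a - b) = rnorm (b - a).
Proof. by rewrite -rnormN opprB. Qed.

Lemma rnormZ z a : rnorm (z *: a) = cabs z * rnorm a.
Proof. by rewrite {1}/rnorm normrZ rnormE cabsE -rmorphM. Qed.

Lemma rnorm0 : rnorm (0 : V) = 0.
Proof. by rewrite /rnorm normr0. Qed.

Lemma rnorm0_eq0 a : rnorm a = 0 -> a = 0.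
Proof. by move=> a0; apply/eqP; rewrite -normr_eq0 rnormE a0. Qed.

Lemma rnorm_eq_small a b : (forall e : R, 0 < e -> rnorm (a - b) <= e) -> a = b.
Proof.
move=> H; apply/eqP; rewrite -subr_eq0; apply/eqP/rnorm0_eq0/eqP.
rewrite eq_le rnorm_ge0 andbT; apply/ler_addgt0Pl => e e0.
by rewrite addr0 H.
Qed.

End NormedC.

(** Comparable complex numbers have equal imaginary parts; hence the radii in the topology of A are
    real. *)
Lemma gt0_complex (R : realType) (e : R[i]) : 0 < e -> exists2 r : R, 0 < r & e = r%:C.
Proof.
by case: e => x y; rewrite ltcE /= => /andP[/eqP -> x0]; exists x.
Qed.

Lemma cauchy_rnorm_cvg (R : realType) (V : completeNormedModType R[i]) (d : nat -> V) :
  (forall e : R, 0 < e -> exists N, forall m n, (N <= m)%N -> (N <= n)%N ->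
     rnorm (d m - d n) <= e) ->
  exists l, forall e : R, 0 < e -> exists N, forall n, (N <= n)%N -> rnorm (l - d n) <= e.
Proof.
move=> H.
have /cauchy_cvgP/cvg_ex[l /cvgrPdist_le Hl] : cauchy (d @ \oo).
  apply/cauchy_ballP => e /gt0_complex[r r0 ->].
  have [N HN] := H (r / 2) (divr_gt0 r0 (ltr0Sn R 1)).
  pose S := [set x | exists2 m, (N <= m)%N & x = d m]; exists (S, S) => /=.
    by split; exists N => // m /= Nm; exists m.
  move=> [_ _] [/= [m Nm ->] [n Nn ->]].
  rewrite -ball_normE /= rnormE ltcR (le_lt_trans (HN _ _ Nm Nn))//.
  by rewrite ltr_pdivrMr// ltr_pMr// ltr1n.
exists l => e e0; have [N _ HN] := Hl e%:C ltac:(by rewrite ltcR).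
by exists N => n Nn; have := HN n Nn; rewrite /= rnormE lecR.
Qed.

Section CstarBasics.
Context {R : realType} {A : cstarAlg R}.
Implicit Types (a b c : A).

Lemma cmulNl a b : (- a) ** b = - (a ** b).
Proof. by rewrite -scaleN1r cmulZl scaleN1r. Qed.

Lemma cmulNr a b : a ** (- b) = - (a ** b).
Proof. by rewrite -scaleN1r cmulZr scaleN1r. Qed.

Lemma cmulBl a b c : (a - b) ** c = a ** c - b ** c.
Proof. by rewrite cmulDl cmulNl. Qed.

Lemma cmulBr a b c : a ** (b - c) = a ** b - a ** c.
Proof. by rewrite cmulDr cmulNr. Qed.

Lemma rnorm_cmul a b : rnorm (a ** b) <= rnorm a * rnorm b.
Proof. by have := cnormM a b; rewrite !rnormE -rmorphM /= lecR. Qed.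

(** The C*-identity gives |a|^2 = |a^* a| <= |a^*| |a|; applied to a and to a^*, it makes the
    involution isometric. *)
Lemma rnorm_star_le a : rnorm a <= rnorm (cstar a).
Proof.
have := cnorm_star a; rewrite !rnormE -rmorphXn => /complexI /= e.
have := rnorm_cmul (cstar a) a; rewrite e expr2.
have [->|a0] := eqVneq (rnorm a) 0; first by rewrite rnorm_ge0.
by rewrite ler_pM2r// lt_neqAle eq_sym a0 rnorm_ge0.
Qed.

Lemma rnorm_cstar a : rnorm (cstar a) = rnorm a.
Proof.
apply/eqP; rewrite eq_le rnorm_star_le andbT.
by have := rnorm_star_le (cstar a); rewrite cstarK.
Qed.

Lemma cstarN a : cstar (- a) = - cstar a.
Proof.
have c0 : cstar (0 : A) = 0.
  by apply: (addrI (cstar 0)); rewrite -cstarD !addr0.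
by apply/eqP; rewrite -addr_eq0 -cstarD addNr c0.
Qed.

Lemma cstarB a b : cstar (a - b) = cstar a - cstar b.
Proof. by rewrite cstarD cstarN. Qed.

End CstarBasics.

Section Diagonal.
Context {R : realType} {X : topologicalType} {phi : X -> X}.
Hypotheses (X_hausdorff : hausdorff_space X) (X_compact : compact [set: X]).
Hypotheses (phi_cont : continuous phi) (phi_locinj : locally_injective phi).
Context {A : cstarAlg R} {iota : (gpd phi -> R[i]) -> A}.
Hypothesis A_reduced : is_reduced_cstar iota.
Implicit Types (g h : X -> R[i]) (d : A).

Notation unitf h := (sect phi 0 h).

Lemma sectD k g h : sect phi k (fun x => g x + h x) = fun c => sect phi k g c + sect phi k h c.
Proof. by apply/funext => c; rewrite /sect; case: ifP => //; rewrite addr0. Qed.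

Lemma sectZ k (z : R[i]) h : sect phi k (fun x => z * h x) = fun c => z * sect phi k h c.
Proof. by apply/funext => c; rewrite /sect; case: ifP => //; rewrite mulr0. Qed.

Lemma alg_star_sect_cts k (h : X -> (R[i] : numFieldType)) : continuous h ->
  alg_star (sect phi k h).
Proof. by move=> hc; apply: alg_star_cc; exact: sect_cts. Qed.

Lemma alg_star_unit_cst (z : R[i]) : alg_star (unitf (fun=> z)).
Proof. by apply: alg_star_sect_cts => x; exact: cvg_cst. Qed.

Lemma alg_star_unitD g h : alg_star (unitf g) -> alg_star (unitf h) ->
  alg_star (unitf (fun x => g x + h x)).
Proof. by rewrite sectD; exact: alg_star_add. Qed.

Lemma alg_star_unitZ z h : alg_star (unitf h) -> alg_star (unitf (fun x => z * h x)).
Proof. by rewrite sectZ; exact: alg_star_scale. Qed.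

Lemma alg_star_unitM g h : alg_star (unitf g) -> alg_star (unitf h) ->
  alg_star (unitf (fun x => g x * h x)).
Proof. by rewrite -unit_conv_sect; exact: alg_star_conv. Qed.

Lemma alg_star_unit_conj h : alg_star (unitf h) ->
  alg_star (unitf (fun x => (h x)^*)).
Proof. by rewrite -invol_unit; exact: alg_star_invol. Qed.

Lemma unit_supportedE (f : gpd phi -> R[i]) : unit_supported f ->
  f = unitf (fun x => f (gunit phi x)).
Proof.
move=> fu; have ga x : gunit phi x = garrow phi 0 x by apply: gpd_eq.
apply/funext => c; have [/eqP e|n] := boolP (c == garrow phi 0 (grng c)).
  by rewrite e sect_arrow ga.
transitivity (0 : R[i]).
  apply/eqP/negPn/negP => /fu[x cx]; move/eqP: n; apply.
  by rewrite cx ga.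
by apply/esym/eqP/negPn/negP => /sect_neq0 e; rewrite -e eqxx in n.
Qed.

Lemma unitf_supported h : unit_supported (unitf h).
Proof. by move=> c /sect_neq0 ->; exists (grng c); apply: gpd_eq. Qed.

Lemma Dfun_ext d g h : Dfun iota d g -> g =1 h -> Dfun iota d h.
Proof. by move=> dg /funext <-. Qed.

Lemma DfunP d h : Dfun iota d h <-> forall e : R, 0 < e -> exists h',
  [/\ alg_star (unitf h'), rnorm (d - iota (unitf h')) < e &
     forall x, cabs (h x - h' x) < e].
Proof.
have ga x : gunit phi x = garrow phi 0 x by apply: gpd_eq.
split=> H e /H.
  move=> [f [fa fu fd fh]]; exists (fun x => f (gunit phi x)).
  by rewrite -unit_supportedE.
move=> [h' [h1 h2 h3]]; exists (unitf h'); split => //.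
  exact: unitf_supported.
by move=> x; rewrite ga sect_arrow; exact: h3.
Qed.

Lemma iota_unit_norm h (C : R) : 0 <= C -> alg_star (unitf h) ->
  (forall x, cabs (h x) <= C) -> rnorm (iota (unitf h)) <= C.
Proof.
move=> C0 ha hC; rewrite -lee_fin iota_norm//; exact: reduced_norm_unit_le.
Qed.

Lemma iota_unit_ge h x : alg_star (unitf h) -> cabs (h x) <= rnorm (iota (unitf h)).
Proof.
by move=> ha; rewrite -lee_fin iota_norm//; exact: reduced_norm_unit_ge.
Qed.

Lemma iota_unitD g h : alg_star (unitf g) -> alg_star (unitf h) ->
  iota (unitf (fun x => g x + h x)) = iota (unitf g) + iota (unitf h).
Proof. by move=> *; rewrite sectD iotaD. Qed.

Lemma iota_unitZ z h : alg_star (unitf h) ->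
  iota (unitf (fun x => z * h x)) = z *: iota (unitf h).
Proof. by move=> *; rewrite sectZ iotaZ. Qed.

Lemma iota_unitM k g h : alg_star (unitf g) -> alg_star (sect phi k h) ->
  iota (sect phi k (fun x => g x * h x)) = iota (unitf g) ** iota (sect phi k h).
Proof. by move=> *; rewrite -unit_conv_sect iotaM. Qed.

Lemma Dfun_norm d h (C : R) : 0 <= C -> Dfun iota d h ->
  (forall x, cabs (h x) <= C) -> rnorm d <= C.
Proof.
move=> C0 /DfunP dh hC; apply/ler_addgt0Pl => e e0.
have [h' [h1 h2 h3]] := dh (e / 2) (divr_gt0 e0 (ltr0Sn R 1)).
have : rnorm (iota (unitf h')) <= C + e / 2.
  apply: iota_unit_norm => //; first by rewrite addr_ge0// divr_ge0// ltW.
  move=> x; rewrite (_ : h' x = h x - (h x - h' x)); last by ring.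
  by rewrite (le_trans (cabsD _ _))// cabsN lerD// ltW.
move=> h4; have := rnormD (d - iota (unitf h')) (iota (unitf h')).
by rewrite subrK; lra.
Qed.

Lemma Dfun_bounded d h : Dfun iota d h -> exists2 C : R, 0 <= C & forall x, cabs (h x) <= C.
Proof.
move=> /DfunP /(_ 1 ltr01)[h' [h1 h2 h3]].
exists (rnorm (iota (unitf h')) + 1); first by rewrite addr_ge0// rnorm_ge0.
move=> x; rewrite (_ : h x = h' x + (h x - h' x)); last by ring.
by rewrite (le_trans (cabsD _ _))// lerD ?iota_unit_ge// ltW.
Qed.

Lemma Dfun_iota h : alg_star (unitf h) -> Dfun iota (iota (unitf h)) h.
Proof.
move=> ha; apply/DfunP => e e0; exists h; split => //.
  by rewrite subrr rnorm0.
by move=> x; rewrite subrr (cabs_real 0) normr0.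
Qed.

Lemma DfunD d d' g h : Dfun iota d g -> Dfun iota d' h ->
  Dfun iota (d + d') (fun x => g x + h x).
Proof.
move=> /DfunP dg /DfunP dh; apply/DfunP => e e0.
have e2 := divr_gt0 e0 (ltr0Sn R 1).
have [g' [g1 g2 g3]] := dg _ e2; have [h' [h1 h2 h3]] := dh _ e2.
exists (fun x => g' x + h' x); split; first exact: alg_star_unitD.
  rewrite iota_unitD// opprD addrACA (splitr e).
  by rewrite (le_lt_trans (rnormD _ _))// ltrD.
by move=> x; rewrite opprD addrACA (splitr e) (le_lt_trans (cabsD _ _))// ltrD.
Qed.

Lemma DfunZ z d h : Dfun iota d h -> Dfun iota (z *: d) (fun x => z * h x).
Proof.
move=> /DfunP dh; apply/DfunP => e e0.
have c0 : 0 < cabs z + 1 by rewrite ltr_wpDl// cabs_ge0.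
have [h' [h1 h2 h3]] := dh _ (divr_gt0 e0 c0).
have le r : 0 <= r -> r < e / (cabs z + 1) -> cabs z * r < e.
  rewrite ltr_pdivlMr// mulrDr mulr1 => r0; apply: le_lt_trans.
  by rewrite mulrC lerDl.
exists (fun x => z * h' x); split; first exact: alg_star_unitZ.
  by rewrite iota_unitZ// -scalerBr rnormZ le// rnorm_ge0.
by move=> x; rewrite -mulrBr cabsM le// cabs_ge0.
Qed.

Lemma DfunN d h : Dfun iota d h -> Dfun iota (- d) (fun x => - h x).
Proof.
move=> /(DfunZ (-1)); rewrite scaleN1r => /Dfun_ext; apply => x.
exact: mulN1r.
Qed.

Lemma DfunB d d' g h : Dfun iota d g -> Dfun iota d' h ->
  Dfun iota (d - d') (fun x => g x - h x).
Proof. by move=> dg /DfunN; exact: DfunD. Qed.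

(** This allows identities in D to be verified pointwise. *)
Lemma Dfun_unique d d' h : Dfun iota d h -> Dfun iota d' h -> d = d'.
Proof.
move=> dh dh'; apply: rnorm_eq_small => e e0.
apply: (Dfun_norm (ltW e0) (DfunB dh dh')) => x.
by rewrite subrr (cabs_real 0) normr0 ltW.
Qed.

Lemma DfunM d d' g h : Dfun iota d g -> Dfun iota d' h ->
  Dfun iota (d ** d') (fun x => g x * h x).
Proof.
move=> dg dh.
have [G G0 gG] := Dfun_bounded dg; have [H H0 hH] := Dfun_bounded dh.
have nG := Dfun_norm G0 dg gG; have nH := Dfun_norm H0 dh hH.
apply/DfunP => e e0.
(* Since dl <= 1, the approximant of the first factor is bounded by G + 1, and the total error is at
   most dl H + (G + 1) dl < e. *)
pose dl := Num.min 1 (e / (2 * (G + H + 2))).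
have GH : 0 < G + H + 2 by lra.
have dl0 : 0 < dl by rewrite lt_min ltr01 divr_gt0// mulr_gt0.
have dl1 : dl <= 1 by rewrite ge_min lexx.
have dle : dl * (G + H + 1) < e.
  have : dl <= e / (2 * (G + H + 2)) by rewrite ge_min lexx orbT.
  rewrite ler_pdivlMr ?mulr_gt0// => k.
  have : 0 <= dl * (G + H) by rewrite mulr_ge0 ?addr_ge0// ltW.
  by lra.
have /DfunP/(_ _ dl0)[g' [g1 g2 g3]] := dg; have /DfunP/(_ _ dl0)[h' [h1 h2 h3]] := dh.
exists (fun x => g' x * h' x); split; first exact: alg_star_unitM.
  rewrite iota_unitM//; set a := iota _ in g2 *; set b := iota _ in h2 *.
  rewrite (_ : d ** d' - a ** b = (d - a) ** d' + a ** (d' - b)); last first.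
    by rewrite cmulBl cmulBr addrA subrK.
  have na : rnorm a <= G + 1.
    have := rnormD (- (d - a)) d; rewrite opprB subrK -opprB rnormN.
    by lra.
  rewrite (le_lt_trans (rnormD _ _))//.
  have := rnorm_cmul (d - a) d'; have := rnorm_cmul a (d' - b) => k1 k2.
  have : rnorm (d - a) * rnorm d' <= dl * H by rewrite ler_pM ?rnorm_ge0// ltW.
  have : rnorm a * rnorm (d' - b) <= (G + 1) * dl by rewrite ler_pM ?rnorm_ge0// ltW.
  by lra.
move=> x; rewrite (_ : _ - _ = (g x - g' x) * h x + g' x * (h x - h' x)); last by ring.
have na : cabs (g' x) <= G + 1.
  rewrite (_ : g' x = g x - (g x - g' x)); last by ring.
  by rewrite (le_trans (cabsD _ _))// cabsN lerD// (le_trans (ltW (g3 x))).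
rewrite (le_lt_trans (cabsD _ _))// !cabsM.
have : cabs (g x - g' x) * cabs (h x) <= dl * H by rewrite ler_pM ?cabs_ge0// ltW.
have : cabs (g' x) * cabs (h x - h' x) <= (G + 1) * dl by rewrite ler_pM ?cabs_ge0// ltW.
by lra.
Qed.

Lemma Dfun_conj d h : Dfun iota d h -> Dfun iota (cstar d) (fun x => (h x)^*).
Proof.
move=> /DfunP dh; apply/DfunP => e /dh[h' [h1 h2 h3]].
exists (fun x => (h' x)^*); split; first exact: alg_star_unit_conj.
  by rewrite -invol_unit iota_star// -cstarB rnorm_cstar.
by move=> x; rewrite -rmorphB cabs_conj.
Qed.

Lemma Dfun_Dalg d h : Dfun iota d h -> Dalg iota d.
Proof.
move=> /DfunP dh; rewrite /Dalg => B /nbhs_ballP[e /gt0_complex[r r0 ->] Bb].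
have [h' [h1 h2 h3]] := dh _ r0.
exists (iota (unitf h')); split.
  by exists (unitf h') => //; split => //; exact: unitf_supported.
by apply: Bb; rewrite -ball_normE /= rnormE ltcR.
Qed.

(** By [Dfun_norm] a uniformly convergent sequence of functions comes from a Cauchy sequence in A,
    whose limit represents h. *)
Lemma Dfun_lim h : (forall e : R, 0 < e -> exists d' h', Dfun iota d' h' /\
    forall x, cabs (h x - h' x) <= e) -> exists d, Dfun iota d h.
Proof.
move=> H.
have /choice[D HD] : forall n : nat, exists dh : A * (X -> R[i]), Dfun iota dh.1 dh.2 /\
    forall x, cabs (h x - dh.2 x) <= n.+1%:R^-1.
  by move=> n; have [|d' [h' dh]] := H n.+1%:R^-1; [rewrite invr_gt0|exists (d', h')].
have small (e : R) : 0 < e -> exists N, forall n, (N <= n)%N -> n.+1%:R^-1 <= e.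
  move=> e0; exists (Num.truncn e^-1) => n Nn.
  rewrite -[leRHS]invrK lef_pV2 ?posrE ?invr_gt0//.
  apply: ltW; apply: (lt_le_trans (truncnS_gt _)).
  by rewrite ler_nat.
have [|l Hl] := @cauchy_rnorm_cvg _ A (fun n => (D n).1).
  move=> e e0; have [N HN] := small (e / 2) (divr_gt0 e0 (ltr0Sn R 1)).
  exists N => m n Nm Nn; apply: (Dfun_norm (ltW e0) (DfunB (HD m).1 (HD n).1)) => x.
  rewrite (_ : _ - _ = (h x - (D n).2 x) - (h x - (D m).2 x)); last by ring.
  rewrite (splitr e) (le_trans (cabsD _ _))// cabsN lerD//.
    exact: le_trans ((HD n).2 x) (HN _ Nn).
  exact: le_trans ((HD m).2 x) (HN _ Nm).
exists l; apply/DfunP => e e0; have e3 : 0 < e / 3 by rewrite divr_gt0.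
have [N1 HN1] := small _ e3; have [N2 HN2] := Hl _ e3.
pose n := maxn N1 N2.
have /DfunP/(_ _ e3)[h' [h1 h2 h3]] := (HD n).1.
exists h'; split => //.
  rewrite (_ : _ - _ = (l - (D n).1) + ((D n).1 - iota (unitf h'))); last first.
    by rewrite addrA subrK.
  rewrite (le_lt_trans (rnormD _ _))//.
  by have := HN2 n (leq_maxr _ _) => k; lra.
move=> x; rewrite (_ : _ - _ = (h x - (D n).2 x) + ((D n).2 x - h' x)); last by ring.
rewrite (le_lt_trans (cabsD _ _))//.
have := le_trans ((HD n).2 x) (HN1 n (leq_maxl _ _)); have := h3 x => k1 k2; lra.
Qed.

Lemma Dfun_cst (z : R[i]) : Dfun iota (iota (unitf (fun=> z))) (fun=> z).
Proof. by apply: Dfun_iota; exact: alg_star_unit_cst. Qed.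

Lemma Dfun_pow d h n : Dfun iota d h -> exists d', Dfun iota d' (fun x => h x ^+ n).
Proof.
move=> dh; elim: n => [|n [d' IH]].
  by exists (iota (unitf (fun=> 1))); exact: Dfun_cst.
by exists (d ** d'); apply: (Dfun_ext (DfunM dh IH)) => x; rewrite exprS.
Qed.

Lemma Dfun_sum (I : Type) (s : seq I) (f : I -> X -> R[i]) :
  (forall i, exists d, Dfun iota d (f i)) ->
  exists d, Dfun iota d (fun x => \sum_(i <- s) f i x).
Proof.
move=> H; elim: s => [|i s [d IH]].
  by exists (iota (unitf (fun=> 0))); apply: (Dfun_ext (Dfun_cst 0)) => x; rewrite big_nil.
have [d' Hd'] := H i; exists (d' + d).
by apply: (Dfun_ext (DfunD Hd' IH)) => x; rewrite big_cons.
Qed.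

(** Since w is bounded, its exponential is a uniform limit of Taylor polynomials in w. *)
Lemma Dfun_expR d (w : X -> R) : Dfun iota d (fun x => (w x)%:C) ->
  exists d', Dfun iota d' (fun x => (expR (w x))%:C).
Proof.
move=> dw; have [M M0 wM] := Dfun_bounded dw.
apply: Dfun_lim => e e0; have [n Hn] := expR_taylor_unif M0 e0.
have [|d' Hd'] := @Dfun_sum _ (index_enum 'I_n) (fun k x => (k`!%:R^-1)%:C * (w x)%:C ^+ k).
  move=> k; have [d' Hd'] := Dfun_pow k dw.
  by exists ((k`!%:R^-1)%:C *: d'); exact: DfunZ.
exists d', (fun x => (\sum_(k < n) w x ^+ k / k`!%:R)%:C); split.
  apply: (Dfun_ext Hd') => x; rewrite rmorph_sum; apply: eq_bigr => k _.
  by rewrite rmorphM rmorphXn mulrC.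
move=> x; rewrite -rmorphB cabs_real; apply: Hn.
by have := wM x; rewrite cabs_real.
Qed.

End Diagonal.

(** Newton interpolation: each new node is corrected by a multiple of a polynomial vanishing at the
    earlier ones. It turns functions of the bounded fiber sizes into polynomials in L 1. *)
Lemma interpolation (F : numFieldType) (q : nat -> F) (K : nat) :
  exists p : {poly F}, forall n, (n <= K)%N -> p.[n%:R] = q n.
Proof.
elim: K => [|K [p Hp]].
  by exists (q 0%N)%:P => n; rewrite leqn0 => /eqP ->; rewrite hornerC.
pose w : {poly F} := \prod_(i < K.+1) ('X - (i : nat)%:R%:P).
have wE x : w.[x] = \prod_(i < K.+1) (x - (i : nat)%:R).
  by rewrite horner_prod; apply: eq_bigr => i _; rewrite hornerXsubC.
exists (p + ((q K.+1 - p.[K.+1%:R]) / w.[K.+1%:R])%:P * w) => n.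
rewrite leq_eqVlt => /orP[/eqP ->|nK].
  rewrite hornerD hornerCM divfK; first by rewrite addrC subrK.
  rewrite wE; apply/prodf_neq0 => i _; rewrite subr_eq0 eqr_nat.
  by rewrite neq_ltn ltn_ord orbT.
rewrite hornerD hornerCM [w.[n%:R]]wE (bigD1 (Ordinal nK))//= subrr mul0r mulr0 addr0.
exact: Hp.
Qed.

(** * The indicator T of the graph of phi and its relation to V_phi *)

Section GraphIndicator.
Context {R : realType} {X : metricType R} {phi : X -> X}.
Hypotheses (X_compact : compact [set: X]).
Hypotheses (phi_cont : continuous phi) (phi_locinj : locally_injective phi).
Hypothesis phi_surj : forall y : X, exists x : X, phi x = y.
Context {A : cstarAlg R} {iota : (gpd phi -> R[i]) -> A}.
Hypothesis A_reduced : is_reduced_cstar iota.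
Implicit Types (g h : X -> R[i]) (d : A).

Let X_hausdorff : hausdorff_space X := @metric_hausdorff _ X.
Let fin : forall x, finite_set (phi @^-1` [set x]) :=
  (fiber_finite_bounded X_compact phi_locinj).1.

Notation unitf h := (sect phi 0 h).
Notation shift := (sect phi 1 (fun=> 1)).

Lemma alg_star_shift : alg_star (shift : gpd phi -> R[i]).
Proof. by apply: alg_star_sect_cts => // x; exact: cvg_cst. Qed.

Lemma shift_mul h : sect phi 1 h = conv (unitf h) shift.
Proof. by rewrite unit_conv_sect; congr (sect phi _); apply/funext => x; rewrite mulr1. Qed.

Lemma alg_star_sect1 h : alg_star (unitf h) -> alg_star (sect phi 1 h).
Proof. by move=> ha; rewrite shift_mul; apply: alg_star_conv => //; exact: alg_star_shift. Qed.

Lemma iota_sect1 h : alg_star (unitf h) ->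
  iota (sect phi 1 h) = iota (unitf h) ** iota shift.
Proof. by move=> ha; rewrite shift_mul iotaM//; exact: alg_star_shift. Qed.

Lemma conv_shift_sect h :
  conv (invol shift) (sect phi 1 h) = unitf (transfer phi h).
Proof.
rewrite conv_invol_sect//; congr (sect phi _); apply/funext => x; apply: eq_bigr => y _.
by rewrite -[RHS]mul1r; congr (_ * _); exact: (@conjc1 R).
Qed.

Lemma alg_star_transfer h : alg_star (unitf h) -> alg_star (unitf (transfer phi h)).
Proof.
move=> ha; rewrite -conv_shift_sect; apply: alg_star_conv.
  by apply: alg_star_invol; exact: alg_star_shift.
exact: alg_star_sect1.
Qed.

Lemma iota_transfer h : alg_star (unitf h) -> iota (unitf (transfer phi h)) =
  cstar (iota shift) ** iota (unitf h) ** iota shift.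
Proof.
move=> ha; rewrite -conv_shift_sect iotaM//.
- by rewrite iota_star//; [rewrite (iota_sect1 ha) cmulA|exact: alg_star_shift].
- by apply: alg_star_invol; exact: alg_star_shift.
- exact: alg_star_sect1.
Qed.

Lemma Dfun_transfer d h : Dfun iota d h ->
  Dfun iota (cstar (iota shift) ** d ** iota shift) (transfer phi h).
Proof.
move=> /DfunP dh; apply/DfunP => e e0.
have [K HK] := (fiber_finite_bounded X_compact phi_locinj).2.
pose t := rnorm (iota shift).
have t0 : 0 <= t by exact: rnorm_ge0.
(* An error dl in d becomes at most dl t^2 in norm, and an error dl in h at most dl K pointwise; dl
   = e / (t^2 + K + 1) makes both smaller than e. *)
have c0 : 0 < t * t + K%:R + 1 by rewrite ltr_wpDl// addr_ge0// mulr_ge0.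
have dl0 : 0 < e / (t * t + K%:R + 1) by rewrite divr_gt0.
have [h' [h1 h2 h3]] := dh _ dl0.
have e2 : e / (t * t + K%:R + 1) * (t * t + K%:R + 1) = e by rewrite divfK// gt_eqF.
set dl := e / _ in dl0 h2 h3 e2.
have tt0 : 0 <= dl * (t * t) by rewrite mulr_ge0 ?(ltW dl0)// mulr_ge0.
have K0 : 0 <= dl * K%:R by rewrite mulr_ge0 ?(ltW dl0).
exists (transfer phi h'); split; first exact: alg_star_transfer.
  rewrite iota_transfer// -cmulBl -cmulBr.
  apply: (@le_lt_trans _ _ (t * dl * t)); last by lra.
  rewrite (le_trans (rnorm_cmul _ _))// ler_wpM2r//.
  rewrite (le_trans (rnorm_cmul _ _))// rnorm_cstar ler_wpM2l//.
  exact: ltW.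
move=> x; apply: (@le_lt_trans _ _ (dl * K%:R)); last by lra.
rewrite /transfer -sumrB.
apply: (@le_trans _ _ (\sum_(y <- fset_set (phi @^-1` [set x])) dl)).
  elim/big_ind2 : _ => [|a b a' b' ab ab'|y _]; last exact: ltW.
    by rewrite (cabs_real 0) normr0.
  by rewrite (le_trans (cabsD _ _))// lerD.
rewrite big_const_seq count_predT iter_addr_0 -[dl *+ _]mulr_natr.
by rewrite ler_wpM2l ?(ltW dl0)// ler_nat; exact: HK.
Qed.

(** The function L 1. Preimages of x itself are counted, whereas [fiber_card] counts those of phi x,
    so that m is [fiber_size] composed with phi. *)
Definition fiber_size (x : X) : nat := #|` fset_set (phi @^-1` [set x])|.

Lemma fiber_size_gt0 x : (0 < fiber_size x)%N.
Proof.
have [y yx] := phi_surj x; rewrite cardfs_gt0; apply/fset0Pn; exists y.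
by rewrite in_fset_set// inE.
Qed.

Lemma alg_star_horner h (p : {poly R[i]}) : alg_star (unitf h) ->
  alg_star (unitf (fun x => p.[h x])).
Proof.
move=> ha; elim/poly_ind: p => [|p c IH].
  under eq_fun do rewrite horner0; exact: alg_star_unit_cst.
under eq_fun do rewrite hornerMXaddC.
by apply: alg_star_unitD; [exact: alg_star_unitM|exact: alg_star_unit_cst].
Qed.

(** L 1 takes its values in {0, ..., K}, where q agrees with a polynomial. *)
Lemma alg_star_fiber_size (q : nat -> R[i]) :
  alg_star (unitf (fun x => q (fiber_size x))).
Proof.
have [K HK] := (fiber_finite_bounded X_compact phi_locinj).2.
have [p Hp] := interpolation q K.
have -> : (fun x => q (fiber_size x)) = (fun x => p.[transfer phi (fun=> 1) x]).
  apply/funext => x; rewrite -Hp ?HK//; congr (_.[_]).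
  by rewrite /transfer big_const_seq count_predT iter_addr_0.
by apply: alg_star_horner; apply: alg_star_transfer; exact: alg_star_unit_cst.
Qed.

(** As m(x) depends on phi x only, the weight of V_phi sits at the source of the arrows, that is to
    the right of T; it is inverted by the square root of the fiber size. *)
Lemma Visom_shift : exists d h, Dfun iota d h /\ iota shift = Visom iota ** d.
Proof.
pose q (n : nat) : R[i] := (Num.sqrt n%:R)%:C.
have VE : @Vfun R X phi = conv shift (unitf (fun x => ((Num.sqrt (fiber_size x)%:R)^-1)%:C)).
  rewrite sect_conv_unit; apply/funext => c; rewrite /Vfun /sect /fiber_card /=.
  by rewrite mul1r.
have aV : alg_star (@Vfun R X phi).
  rewrite VE; apply: alg_star_conv; first exact: alg_star_shift.
  exact: (alg_star_fiber_size (fun n => ((Num.sqrt n%:R)^-1)%:C)).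
exists (iota (unitf (fun x => q (fiber_size x)))), (fun x => q (fiber_size x)).
have aq := alg_star_fiber_size q.
split; first exact: Dfun_iota.
rewrite /Visom -iotaM//; congr iota.
rewrite VE sect_conv_unit sect_conv_unit; congr (sect phi _); apply/funext => x.
rewrite mul1r -rmorphM mulVf// gt_eqF// sqrtr_gt0 ltr0n; exact: fiber_size_gt0.
Qed.

End GraphIndicator.

(** * States and the KMS condition *)

Section States.
Context {R : realType} {A : cstarAlg R} (omega : {scalar A}).
Hypothesis state : is_state omega.
Implicit Types a : A.

Lemma state_ge0 a : complex.Im (omega (cstar a ** a)) = 0 /\
  0 <= complex.Re (omega (cstar a ** a)).
Proof.
by have := state.1 a; rewrite lecE /= => /andP[/eqP -> ->].
Qed.

Lemma state_ball a : rnorm a <= 1 -> cabs (omega a) <= 1.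
Proof.
move=> a1; rewrite -lee_fin -state.2; apply: ereal_sup_ubound.
by exists a => //=; rewrite rnormE lecR.
Qed.

Lemma state_le a : cabs (omega a) <= rnorm a.
Proof.
have [a0|a0] := eqVneq (rnorm a) 0.
  by rewrite (rnorm0_eq0 a0) linear0 (cabs_real 0) normr0 rnorm0.
have ap : 0 < rnorm a by rewrite lt_neqAle eq_sym a0 rnorm_ge0.
have := @state_ball (((rnorm a)^-1)%:C *: a).
have r0 : 0 <= (rnorm a)^-1 by rewrite invr_ge0 ltW.
rewrite rnormZ linearZ /= cabsM !cabs_real !(ger0_norm r0) mulVf// lexx.
by move=> /(_ isT); rewrite ler_pdivrMl// mulr1.
Qed.

Lemma cstar1 : cstar (cone A) = cone A.
Proof.
have := cstarM (cstar (cone A)) (cone A).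
by rewrite cmul1r cstarK cmul1r.
Qed.

Lemma rnorm1_le : rnorm (cone A) <= 1.
Proof.
have := cnorm_star (cone A); rewrite cstar1 cmul1r !rnormE -rmorphXn => /complexI /= e.
have := rnorm_ge0 (cone A); rewrite expr2 in e => n0.
have [->|n1] := eqVneq (rnorm (cone A)) 0; first exact: ler01.
have np : 0 < rnorm (cone A) by rewrite lt_neqAle eq_sym n1.
by rewrite -(ler_pM2l np) mulr1 -e.
Qed.

Lemma state_shift a (s : R[i]) :
  omega (cstar (a + s *: cone A) ** (a + s *: cone A)) =
  omega (cstar a ** a) + s * omega (cstar a) + s^* * omega a + s^* * s * omega (cone A).
Proof.
rewrite cstarD cstarZ cstar1 !cmulDl !cmulDr !cmulZl !cmulZr cmul1l cmul1r cmul1l.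
rewrite !linearD !linearZ /=.
rewrite -!addrA; congr (_ + _); congr (_ + _); congr (_ + _).
by rewrite mulrA.
Qed.

(** The numbers omega(b^* b) are real for b = a + 1 and b = a + i; their expansions give the two
    real equations needed. *)
Lemma state_conj a : omega (cstar a) = (omega a)^*.
Proof.
have [i1 _] := state_ge0 a; have [i2 _] := state_ge0 (cone A).
have [i3 _] := state_ge0 (a + 1 *: cone A).
have [i4 _] := state_ge0 (a + (0 +i* 1) *: cone A).
move: i3 i4; rewrite !state_shift; move: i1 i2; rewrite cstar1 cmul1r.
case: (omega (cstar a ** a)) => x1 y1; case: (omega (cstar a)) => x2 y2.
case: (omega a) => x3 y3; case: (omega (cone A)) => x4 y4 /= -> -> h1 h2.
by apply/eqP; rewrite eq_complex /=; apply/andP; split; apply/eqP; lra.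
Qed.

(** The definition of a state fixes only the norm. If w = omega(1) were less than 1, positivity
    would keep |omega| away from 1 on the whole unit ball. *)
Lemma state1 : omega (cone A) = 1.
Proof.
have [i2 w0] := state_ge0 (cone A); rewrite cstar1 cmul1r in i2 w0.
set w := complex.Re (omega (cone A)) in w0.
have ew : omega (cone A) = w%:C.
  by apply/eqP; rewrite eq_complex /= i2 !eqxx.
have w1 : w <= 1.
  have := le_trans (state_le (cone A)) rnorm1_le.
  by rewrite ew cabs_real ger0_norm.
(* positivity of [(a - omega(a) 1)^* (a - omega(a) 1)] *)
have key a : rnorm a <= 1 -> cabs (omega a) ^+ 2 * (2 - w) <= 1.
  move=> a1; have [_] := state_ge0 (a + (- omega a) *: cone A).
  rewrite state_shift state_conj ew.
  have : complex.Re (omega (cstar a ** a)) <= 1.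
    rewrite (le_trans (ler_norm _))// (le_trans (cabs_Re _))// (le_trans (state_le _))//.
    by rewrite (le_trans (rnorm_cmul _ _))// rnorm_cstar mulr_ile1// rnorm_ge0.
  have : cabs (omega a) ^+ 2 = complex.Re (omega a) ^+ 2 + complex.Im (omega a) ^+ 2.
    by rewrite cabs_def sqr_sqrtr// addr_ge0 ?sqr_ge0.
  move=> ->; case: (omega (cstar a ** a)) => x1 y1; case: (omega a) => x y /= h1 h2.
  by lra.
rewrite ew; suff -> : w = 1 by [].
apply/eqP; rewrite eq_le w1 /= leNgt; apply/negP => wlt.
(* By [key], b bounds |omega| on the unit ball; it is less than 1 because w < 1. *)
pose b := Num.sqrt (2 - w)^-1.
have w2 : 1 < 2 - w by lra.
have w20 : 0 < 2 - w by lra.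
have b1 : b < 1.
  by rewrite -sqrtr1 ltr_sqrt// invf_lt1.
suff : (1%:E <= b%:E)%E by rewrite lee_fin leNgt b1.
rewrite -state.2; apply: ge_ereal_sup => _ [a /= a1 <-].
rewrite lee_fin -[X in X <= _]/(cabs (omega a)) -[leLHS]ger0_norm ?cabs_ge0// -sqrtr_sqr.
rewrite /b ler_sqrt; last by rewrite invr_ge0 ltW.
rewrite -[leRHS]mul1r ler_pdivlMr//.
by apply: key; rewrite rnormE lecR in a1.
Qed.

End States.

Section Unit.
Context {R : realType} {X : metricType R} {phi : X -> X}.
Hypotheses (X_compact : compact [set: X]).
Hypotheses (phi_cont : continuous phi) (phi_locinj : locally_injective phi).
Context {A : cstarAlg R} {iota : (gpd phi -> R[i]) -> A}.
Hypothesis A_reduced : is_reduced_cstar iota.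

(** The indicator of the unit space is a left unit on the dense image of [iota], hence on A. *)
Lemma iota_one : iota (sect phi 0 (fun=> 1)) = cone A.
Proof.
set u := iota _.
have a1 : alg_star (sect phi 0 (fun=> 1 : R[i])).
  exact: (alg_star_unit_cst (@metric_hausdorff _ X) X_compact phi_cont phi_locinj).
have H a : u ** a = a.
  apply: rnorm_eq_small => e e0.
  pose t := rnorm u + 1; have t0 : 0 < t by rewrite ltr_wpDl// rnorm_ge0.
  have et : 0 < e / t by rewrite divr_gt0.
  have : closure (iota @` (@alg_star R X phi)) a by rewrite (iota_dense A_reduced).
  move=> /(_ (ball a (e / t)%:C)) [|_ [[f fa <-]]].
    by apply: nbhsx_ballx; rewrite ltcR.
  rewrite -ball_normE /= rnormE ltcR => fe.
  have uf : u ** iota f = iota f.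
    rewrite -iotaM//; congr iota; apply/funext => c.
    by rewrite conv_unitl mul1r.
  rewrite (_ : u ** a - a = u ** (a - iota f) - (a - iota f)); last first.
    by rewrite cmulBr uf opprB addrA subrK.
  rewrite (le_trans (rnormD _ _))// rnormN.
  have k := rnorm_cmul u (a - iota f).
  apply: (@le_trans _ _ (t * rnorm (a - iota f))).
    by rewrite /t mulrDl mul1r; lra.
  by rewrite mulrC -ler_pdivlMr// ltW.
by rewrite -[LHS]cmul1r H.
Qed.

End Unit.

(** * Norm-differentiable exponential families *)

Section ExpFamily.
Context {R : realType} {X : topologicalType} {phi : X -> X}.
Hypotheses (X_hausdorff : hausdorff_space X) (X_compact : compact [set: X]).
Hypotheses (phi_cont : continuous phi) (phi_locinj : locally_injective phi).
Context {A : cstarAlg R} {iota : (gpd phi -> R[i]) -> A}.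
Hypothesis A_reduced : is_reduced_cstar iota.

(** The difference quotient of E minus its expected derivative dw E(z) belongs to D, so its norm is
    estimated pointwise by [cexp_est]. The outer factors a and b accommodate the T and T^* of the
    KMS condition. *)
Lemma exp_family_derivable (w : X -> R[i]) (dw : A) (E : R[i] -> A) (a b : A)
    (z : (R[i] : numFieldType)) :
  Dfun iota dw w -> (forall z, Dfun iota (E z) (fun x => cexp (z * w x))) ->
  derivable ((fun z => a ** E z ** b) : (R[i] : numFieldType) -> A) z 1.
Proof.
move=> hw hE.
have [W W0 wW] := Dfun_bounded A_reduced hw.
have [B B0 eB] := Dfun_bounded A_reduced (hE z).
apply/cvg_ex; exists (a ** (dw ** E z) ** b); apply/cvgrPdist_le => _/gt0_complex[e e0 ->].
pose C := rnorm a * (7 * B * W ^+ 2) * rnorm b.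
have C0 : 0 <= C by rewrite !mulr_ge0 ?rnorm_ge0 ?sqr_ge0.
(* The first bound keeps h w within the range of [cexp_est]; the second makes the final error r C at
   most e. *)
pose r := Num.min (1 / 2 / (W + 1)) (e / (C + 1)).
have r0 : 0 < r by rewrite lt_min !divr_gt0// ltr_wpDl.
have rW : r * W <= 1 / 2.
  have : r <= 1 / 2 / (W + 1) by rewrite ge_min lexx.
  by rewrite ler_pdivlMr ?ltr_wpDl// => h; have := ltW r0; lra.
have rC : r * C <= e.
  have : r <= e / (C + 1) by rewrite ge_min lexx orbT.
  by rewrite ler_pdivlMr ?ltr_wpDl// => h; have := ltW r0; lra.
near=> h.
have h0 : h != 0 by near: h; exact: nbhs_dnbhs_neq.
have hr : cabs h < r.
  near: h; apply: nbhs_dnbhs; apply/nbhs_ballP; exists r%:C; first by rewrite /= ltcR.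
  by move=> y; rewrite -ball_normE /= sub0r normrN cabsE ltcR.
rewrite /= [_ *: 1]mulr1 rnormE lecR rnormB.
set D := h^-1 *: (E (h + z) - E z) - dw ** E z.
have -> : h^-1 *: (a ** E (h + z) ** b - a ** E z ** b) - a ** (dw ** E z) ** b = a ** D ** b.
  by rewrite /D -cmulBl -cmulBr -cmulZl -cmulZr -cmulBl -cmulBr.
have hD : Dfun iota D (fun x => h^-1 * (cexp ((h + z) * w x) - cexp (z * w x)) -
    w x * cexp (z * w x)).
  apply: DfunB => //; last exact: DfunM.
  by apply: DfunZ => //; exact: DfunB.
have nD : rnorm D <= 7 * B * W ^+ 2 * r.
  apply: (Dfun_norm A_reduced _ hD) => [|x].
    by rewrite !mulr_ge0 ?sqr_ge0 ?(ltW r0).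
  have hw2 : cabs (h * w x) <= 1 / 2.
    by rewrite cabsM (le_trans _ rW)// ler_pM ?cabs_ge0 ?(ltW hr).
  have -> : h^-1 * (cexp ((h + z) * w x) - cexp (z * w x)) - w x * cexp (z * w x) =
      cexp (z * w x) * (h^-1 * (cexp (h * w x) - 1 - h * w x)).
    rewrite mulrDl cexpD; field.
    exact: h0.
  have hp : 0 < cabs h.
    rewrite lt_neqAle cabs_ge0 andbT eq_sym; apply/eqP => /cabs0_eq0 h00.
    by rewrite h00 eqxx in h0.
  have hinv : cabs h^-1 * cabs h = 1.
    by rewrite -cabsM mulVf// (cabs_real 1) normr1.
  rewrite (cabsM (cexp (z * w x))) (cabsM h^-1).
  have := cexp_est hw2; rewrite (cabsM h) exprMn => est.
  have w2 : cabs (w x) ^+ 2 <= W ^+ 2 by rewrite lerXn2r ?nnegrE ?cabs_ge0.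
  have : cabs h^-1 * cabs (cexp (h * w x) - 1 - h * w x) <= 7 * W ^+ 2 * r.
    rewrite -(ler_pM2l hp) mulrA [cabs h * _]mulrC hinv mul1r.
    apply: (le_trans est).
    have : cabs h ^+ 2 * cabs (w x) ^+ 2 <= cabs h ^+ 2 * W ^+ 2 by rewrite ler_wpM2l ?sqr_ge0.
    have : (cabs h * W ^+ 2) * cabs h <= (cabs h * W ^+ 2) * r.
      by rewrite ler_wpM2l ?(ltW hr)// mulr_ge0 ?cabs_ge0 ?sqr_ge0.
    rewrite (_ : cabs h * W ^+ 2 * cabs h = cabs h ^+ 2 * W ^+ 2); last by ring.
    rewrite (_ : cabs h * (7 * W ^+ 2 * r) = 7 * (cabs h * W ^+ 2 * r)); last by ring.
    by lra.
  move=> k; rewrite (_ : 7 * B * W ^+ 2 * r = B * (7 * W ^+ 2 * r)); last by ring.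
  by apply: ler_pM => //; rewrite ?mulr_ge0 ?cabs_ge0.
apply: (le_trans _ rC).
rewrite (_ : r * C = rnorm a * (7 * B * W ^+ 2 * r) * rnorm b); last by rewrite /C; ring.
rewrite (le_trans (rnorm_cmul _ _))// ler_wpM2r ?rnorm_ge0//.
by rewrite (le_trans (rnorm_cmul _ _))// ler_wpM2l ?rnorm_ge0.
Unshelve. all: by end_near. Qed.

End ExpFamily.

Lemma continuous_complex (R : realType) (X : topologicalType) (h : X -> R) :
  continuous h -> continuous ((fun x => (h x)%:C) : X -> (R[i] : numFieldType)).
Proof.
move=> hc x; apply/cvgrPdist_lt => _/gt0_complex[e e0 ->].
have /cvgrPdist_lt/(_ _ e0) := hc x; apply: filterS => y.
by rewrite -rmorphB cabsE cabs_real ltcR.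
Qed.

(** * From the KMS condition to invariance under the Ruelle operator *)

Section KMSidentity.
Context {R : realType} {X : metricType R} {phi : X -> X}.
Hypotheses (X_compact : compact [set: X]).
Hypotheses (phi_cont : continuous phi) (phi_locinj : locally_injective phi).
Hypothesis phi_surj : forall y : X, exists x : X, phi x = y.
Context {A : cstarAlg R} {iota : (gpd phi -> R[i]) -> A}.
Hypothesis A_reduced : is_reduced_cstar iota.
Context (F : X -> R) (dF : A) (alpha : R -> A -> A).
Hypotheses (hF : Dfun iota dF (fun x => (F x)%:C)) (alphaF : is_action_of iota F alpha).
Context (beta : R) (omega : {scalar A}).
Hypothesis omega_KMS : is_KMS_state alpha beta omega.

Let X_hausdorff : hausdorff_space X := @metric_hausdorff _ X.

Notation unitf h := (sect phi 0 h).
Notation shift := (sect phi 1 (fun=> 1)).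

(** For z = a + ib the function is e^(-bF) e^(iaF): the real exponential is in D by [Dfun_expR], and
    the unimodular factor is supplied by the action on V_phi. *)
Lemma exp_family : exists E : R[i] -> A,
  forall z, Dfun iota (E z) (fun x => cexp (z * (0 +i* F x))).
Proof.
suff /choice[E hE] : forall z : R[i], exists d, Dfun iota d (fun x => cexp (z * (0 +i* F x))).
  by exists E.
move=> [a b].
have [u hu _] := action_Visom alphaF a.
have hb : Dfun iota ((- b)%:C *: dF) (fun x => (- b * F x)%:C).
  by apply: (Dfun_ext (DfunZ A_reduced _ hF)) => x; rewrite rmorphM.
have [v hv] := Dfun_expR X_hausdorff X_compact phi_cont phi_locinj A_reduced hb.
exists (v ** u); apply: (Dfun_ext (DfunM A_reduced hv hu)) => x.
by rewrite /cexp /= !mulr0 sub0r addr0 mulNr.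
Qed.

Lemma action_fixed t d h : Dfun iota d h -> alpha t d = d.
Proof. by move=> /Dfun_Dalg hd; exact: (action_Dalg alphaF). Qed.

(** In T = V_phi d the factor d is fixed by the action, so T is multiplied by the same e^(itF) as
    V_phi. *)
Lemma action_shift (E : R[i] -> A) t :
  (forall z, Dfun iota (E z) (fun x => cexp (z * (0 +i* F x)))) ->
  alpha t (iota shift) = E t%:C ** iota shift.
Proof.
move=> hE; have act := is_action_of_action alphaF.
have [d [h [hd ->]]] := Visom_shift X_compact phi_cont phi_locinj phi_surj A_reduced.
have [u hu eu] := action_Visom alphaF t.
rewrite (actionM act) eu (action_fixed t hd) cmulA; congr (_ ** _ ** _).
apply: (Dfun_unique A_reduced hu); apply: (Dfun_ext (hE _)) => x.
by rewrite /cexp /= !mulr0 mul0r subr0 !addr0 expR0 mul1r.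
Qed.

Lemma expi_conj (t : R) : (expi t)^* = expi (- t).
Proof. by rewrite /expi cosN sinN. Qed.

(** Equality of omega at two elements of D given by their functions; by [Dfun_unique] the choice of
    d1 and d2 is immaterial. *)
Definition same_value (f g : X -> R[i]) : Prop :=
  exists d1 d2, [/\ Dfun iota d1 f, Dfun iota d2 g & omega d1 = omega d2].

(** The Ruelle operator of the potential - beta F; the aim is that its dual fixes omega on D. *)
Definition ruelle (g : X -> R[i]) : X -> R[i] :=
  transfer phi (fun x => (expR (- (beta * F x)))%:C * g x).

(* The KMS condition for [h T] and [(h T)^* d], where [T] = [iota shift]. *)
Lemma KMS_local (h : X -> R) (g : X -> R[i]) (d : A) : continuous h ->
  (forall y z, h y != 0 -> h z != 0 -> phi y = phi z -> y = z) ->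
  Dfun iota d g ->
  same_value (fun x => (h x ^+ 2)%:C * g x) (ruelle (fun x => (h x ^+ 2)%:C * g x)).
Proof.
move=> hc hinj hd; have act := is_action_of_action alphaF.
have [E hE] := exp_family.
pose hC x := (h x)%:C.
have ah : alg_star (unitf hC).
  apply: alg_star_sect_cts => //; exact: continuous_complex.
have hh : Dfun iota (iota (unitf hC)) hC by exact: Dfun_iota.
set k := iota (unitf hC) in hh; set T := iota shift.
have kT : k ** T = iota (sect phi 1 hC) by rewrite -iota_sect1.
have kk : cstar k = k.
  rewrite -iota_star// invol_unit; congr (iota (sect phi 0 _)); apply/funext => x.
  by rewrite /hC; apply/eqP; rewrite eq_complex /= oppr0 !eqxx.
have hkd : Dfun iota (k ** d) (fun x => hC x * g x) by exact: DfunM.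
have hw : Dfun iota ('i%C *: dF) (fun x => 0 +i* F x).
  apply: (Dfun_ext (DfunZ A_reduced _ hF)) => x.
  apply/eqP; rewrite eq_complex /=.
  by rewrite !(mul0r, mul1r, mulr0, subr0, addr0, sub0r, add0r, oppr0) !eqxx.
have hwN : Dfun iota (- ('i%C *: dF)) (fun x => - (0 +i* F x)) by exact: DfunN.
have ext1 : analytic_extension alpha (k ** T) (fun z => k ** E z ** T).
  split => [z|t]; first exact: (exp_family_derivable A_reduced hw hE).
  by rewrite (actionM act) (action_fixed t hh) (action_shift t hE) cmulA.
(* At real times T^* is multiplied on the right by E(t)^* = E(- t). The extension uses E(- z), which
   is holomorphic in z, instead of E(z)^*, which is not in general. *)
have ext2 : analytic_extension alpha (cstar T ** (k ** d))
    (fun z => cstar T ** E (- z) ** (k ** d)).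
  split => [z|t].
    apply: (exp_family_derivable (E := fun z => E (- z)) A_reduced hwN) => z'.
    by apply: (Dfun_ext (hE _)) => x; rewrite mulNr mulrN.
  rewrite (actionM act) (action_star act) (action_shift t hE) (action_fixed t hkd) cstarM.
  congr (_ ** _ ** _).
  apply: (Dfun_unique A_reduced (hE _)); apply: (Dfun_ext (Dfun_conj A_reduced (hE _))) => x.
  rewrite /cexp /= !mulr0 !mul0r !subr0 !addr0 oppr0 mul0r !subr0 expR0 !mul1r.
  by rewrite mulNr -expi_conj.
have := omega_KMS.2 _ _ _ ext1 (ex_intro _ _ ext2).
rewrite kT => KMS.
exists (iota (sect phi 1 hC) ** (cstar T ** (k ** d))).
exists (cstar T ** (k ** d) ** (k ** E (0 +i* beta) ** T)); split => //.
  (* The product regroups as (k T)(k T)^* d, where (k T)(k T)^* is diagonal because phi is injective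
     where h does not vanish. *)
  rewrite cmulA (_ : _ ** (_ ** _) = (iota (sect phi 1 hC) ** cstar (k ** T)) ** d); last first.
    by rewrite cstarM kk !cmulA.
  rewrite kT -(iota_star A_reduced); last exact: alg_star_sect1.
  rewrite -(iotaM A_reduced); last 2 first.
  - exact: alg_star_sect1.
  - by apply: alg_star_invol; exact: alg_star_sect1.
  have hC0 x : hC x != 0 -> h x != 0.
    by apply: contraNN => /eqP h0; rewrite /hC h0.
  rewrite conv_sect_invol; last by move=> x y /hC0 hx /hC0 hy; exact: hinj.
  have a2 : alg_star (unitf (fun x => hC x * (hC x)^*)).
    by apply: alg_star_unitM => //; exact: alg_star_unit_conj.
  apply: (Dfun_ext (DfunM A_reduced (Dfun_iota a2) hd)) => x; congr (_ * _).
  by apply/eqP; rewrite eq_complex /= !(oppr0, mulr0, mul0r, subr0, addr0) expr2 !eqxx.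
rewrite (_ : _ ** _ = cstar T ** (k ** d ** (k ** E (0 +i* beta))) ** T); last first.
  by rewrite !cmulA.
have := DfunM A_reduced hkd (DfunM A_reduced hh (hE (0 +i* beta))).
move=> /(Dfun_transfer X_compact phi_cont phi_locinj A_reduced)/Dfun_ext; apply => x.
congr (transfer _ _ x); apply/funext => y.
(* At z = i beta the exponent z (iF) is the real number - beta F, and the trigonometric factor is
   1. *)
rewrite /cexp /= mulr0 !mul0r mulr0 addr0 sub0r /expi cos0 sin0 /hC.
have -> : (h y ^+ 2)%:C = (h y)%:C * (h y)%:C :> R[i] by rewrite expr2 rmorphM.
have -> : 1 +i* 0 = 1 :> R[i] by [].
by rewrite mulr1; ring.
Qed.

Lemma same_value_sum (I : Type) (s : seq I) (f g : I -> X -> R[i]) :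
  (forall i, same_value (f i) (g i)) ->
  same_value (fun x => \sum_(i <- s) f i x) (fun x => \sum_(i <- s) g i x).
Proof.
move=> fg; elim: s => [|i s [d1 [d2 [h1 h2 e]]]].
  (* The empty sum is the zero function, represented by a zero multiple of dF. *)
  exists (0 *: dF), (0 *: dF); split => //; apply: (Dfun_ext (DfunZ A_reduced 0 hF)) => x;
    by rewrite big_nil mul0r.
have [d1' [d2' [h1' h2' e']]] := fg i.
exists (d1' + d1), (d2' + d2); split; last by rewrite !linearD /= e e'.
  by apply: (Dfun_ext (DfunD A_reduced h1' h1)) => x; rewrite big_cons.
by apply: (Dfun_ext (DfunD A_reduced h2' h2)) => x; rewrite big_cons.
Qed.

Lemma same_value_trans f g h : same_value f g -> same_value g h -> same_value f h.
Proof.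
move=> [d1 [d2 [h1 h2 e]]] [d3 [d4 [h3 h4 e']]]; exists d1, d4; split => //.
by rewrite e -e' (Dfun_unique A_reduced h2 h3).
Qed.

(** [KMS_local] involves squares of bumps, so the partition of unity is f_x^2 / s with s the sum of
    these squares. The factor 1 / s is continuous, as s vanishes nowhere, and is absorbed into g. *)
Lemma KMS_ruelle (g : X -> R[i]) (d : A) : Dfun iota d g -> same_value g (ruelle g).
Proof.
move=> hd; have [D [f [fc finj fcov]]] := locinj_bumps X_compact phi_locinj.
pose s y := \sum_(x <- D) f x y ^+ 2.
have s0 y : s y != 0.
  have [x xD fxy] := fcov y; rewrite /s gt_eqF// (big_rem x)//=.
  rewrite ltr_pwDl ?sumr_ge0// => [|? _]; last exact: sqr_ge0.
  by rewrite lt_neqAle eq_sym sqrf_eq0 fxy sqr_ge0.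
have sc : continuous s.
  rewrite /s; elim: (enum_fset D) => [|x t IH].
    rewrite (_ : (fun y => _) = cst 0); first by move=> y; exact: cvg_cst.
    by apply/funext => y; rewrite big_nil.
  rewrite (_ : (fun y => _) = (fun y => f x y * f x y + \sum_(z <- t) f z y ^+ 2)).
    by move=> y; apply: cvgD (IH y); apply: cvgM; exact: fc.
  by apply/funext => y; rewrite big_cons expr2.
have sVc : continuous (fun y => (s y)^-1).
  by move=> y; apply: cvgV => //; exact: sc.
have as_ : alg_star (unitf (fun y => ((s y)^-1)%:C)).
  by apply: alg_star_sect_cts => //; exact: continuous_complex.
have hgs := DfunM A_reduced (Dfun_iota as_) hd.
have := same_value_sum (enum_fset D) (fun x => KMS_local (fc x) (finj x) hgs).
have gE y : g y = \sum_(x <- D) (f x y ^+ 2)%:C * (((s y)^-1)%:C * g y).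
  rewrite -mulr_suml -(rmorph_sum (real_complex R)) mulrA -rmorphM mulfV ?mul1r//.
  exact: s0.
move=> [d1 [d2 [h1 h2 e]]]; exists d1, d2; split => //.
  by apply: (Dfun_ext h1) => y; rewrite -gE.
apply: (Dfun_ext h2) => y; rewrite /ruelle /transfer exchange_big /=.
by apply: eq_bigr => z _; rewrite -mulr_sumr -gE.
Qed.

Lemma same_value_iter n : same_value (fun=> 1) (iter n ruelle (fun=> 1)).
Proof.
elim: n => [|n IH].
  have h1 := Dfun_cst X_hausdorff X_compact phi_cont phi_locinj (iota := iota) 1.
  by exists (iota (unitf (fun=> 1))), (iota (unitf (fun=> 1))).
by apply: (same_value_trans IH); have [_ [d [_ hd _]]] := IH; exact: KMS_ruelle hd.
Qed.

Lemma iter_ruelle n : iter n ruelle (fun=> 1) = fun x =>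
  (iter n (transfer phi) (fun y => expR (- birkhoff_sum phi (fun z => beta * F z) n y)) x)%:C.
Proof.
have fin := (fiber_finite_bounded X_compact phi_locinj).1.
rewrite /ruelle transfer_weight//; apply/funext => x.
rewrite !transfer_iter// rmorph_sum; apply: eq_bigr => y _.
by rewrite expR_birkhoff mulr1 rmorph_prod.
Qed.

(** Let u be the element of D given by the iterated function, so that omega u = 1. As c >= 0, u has
    norm at most C, whence 1 <= C. Also C - u has norm at most C - c, whence C - 1 <= C - c. *)
Lemma KMS_bounds n (c C : R) : [set: X] !=set0 -> 0 <= c ->
  (forall x, c <= iter n (transfer phi)
    (fun y => expR (- birkhoff_sum phi (fun z => beta * F z) n y)) x <= C) ->
  c <= 1 <= C.
Proof.
move=> [x0 _] c0 cC; have [d1 [d2 [h1 h2 e]]] := same_value_iter n.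
have cC0 : c <= C by have /andP[k1 k2] := cC x0; exact: le_trans k1 k2.
have st := omega_KMS.1.
have w1 : omega d1 = 1.
  have h := Dfun_cst X_hausdorff X_compact phi_cont phi_locinj (iota := iota) 1.
  rewrite (Dfun_unique A_reduced h1 h) (iota_one X_compact phi_cont phi_locinj A_reduced).
  exact: state1.
rewrite w1 in e; rewrite iter_ruelle in h2.
apply/andP; split.
  have h := DfunB A_reduced (DfunZ A_reduced C%:C h1) h2.
  have n1 : rnorm (C%:C *: d1 - d2) <= C - c.
    apply: (Dfun_norm A_reduced _ h) => [|x]; first by rewrite subr_ge0.
    rewrite mulr1 -rmorphB cabs_real; have /andP[k1 k2] := cC x.
    by rewrite ger0_norm; lra.
  have := le_trans (state_le st _) n1.
  rewrite linearB linearZ /= w1 -e mulr1 -[1]/(1%:C) -rmorphB cabs_real.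
  by have := ler_norm (C - 1) => ? ?; lra.
have := state_le st d2; rewrite -e (cabs_real 1) normr1 => /le_trans; apply.
apply: (Dfun_norm A_reduced _ h2) => [|x]; first exact: le_trans cC0.
rewrite cabs_real; have /andP[k1 k2] := cC x.
by rewrite ger0_norm// (le_trans c0).
Qed.

End KMSidentity.

Theorem proposition6p5 (R : realType) (X : metricType R) (phi : X -> X)
  (X_nonempty : [set: X] !=set0) (X_compact : compact [set: X])
  (phi_continuous : continuous phi) (phi_locinj : locally_injective phi)
  (phi_surj : forall y : X, exists x : X, phi x = y)
  (A : cstarAlg R) (iota : (gpd phi -> R[i]) -> A)
  (A_reduced : is_reduced_cstar iota)
  (F : X -> R) (F_in_D : in_D iota F)
  (alpha : R -> A -> A) (alphaF : is_action_of iota F alpha)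
  (beta : R) (omega : {scalar A}) (omega_KMS : is_KMS_state alpha beta omega) :
  (0 < beta ->
     lower_mean phi (log_m phi) <= beta * upper_mean phi F /\
     beta * lower_mean phi F <= h_m phi) /\
  (beta < 0 ->
     lower_mean phi (log_m phi) <= beta * lower_mean phi F /\
     beta * upper_mean phi F <= h_m phi).
Proof.
have [dF hF] := F_in_D.
have [M M0 FM'] := Dfun_bounded A_reduced hF.
have FM x : `|F x| <= M by have := FM' x; rewrite cabs_real.
have FNM x : `|- F x| <= M by rewrite normrN.
have bM x : `|beta * F x| <= `|beta| * M by rewrite normrM ler_wpM2l.
have [U L] := mean_inequalities X_nonempty X_compact phi_locinj phi_surj bM
  (fun n c C => KMS_bounds X_compact phi_continuous phi_locinj phi_surj A_reduced
    hF alphaF omega_KMS X_nonempty).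
have [_ eL] := lower_meanE phi X_nonempty bM.
have [_ eF] := lower_meanE phi X_nonempty FM.
split => b0.
  rewrite -(upper_meanZ phi X_nonempty b0 FM); split => //.
  rewrite eF mulrN -(upper_meanZ phi X_nonempty b0 FNM).
  move: L; rewrite eL; congr (- upper_mean phi _ <= _).
  by apply/funext => x; rewrite mulrN.
(* For negative beta, beta F is read as (- beta)(- F), which exchanges the upper and lower means of
   F. *)
have nb : 0 < - beta by rewrite oppr_gt0.
split.
  rewrite eF mulrN -mulNr -(upper_meanZ phi X_nonempty nb FNM).
  move: U; congr (_ <= upper_mean phi _).
  by apply/funext => x; rewrite mulrNN.
rewrite -[beta]opprK mulNr -(upper_meanZ phi X_nonempty nb FM).
move: L; rewrite eL; congr (- upper_mean phi _ <= _).
by apply/funext => x; rewrite mulNr.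
Qed.
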